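(* There exist two positive constants $c_1$ and $c_2$ such that for all real numbers $r\ge \ell\ge 1$ and every $w\in[0,1]$, \[ c_1\left(1+\min\left(\ell r^{-1/3},\ \ell\,\delta_{w,\ell r^{-1}}\right)\right)\le N_{w,\ell,r}\le c_2\left(1+\min\left(\ell r^{-1/3},\ \ell\,\delta_{w,\ell r^{-1}}\right)\right), \] where $\delta_{w,x}=\min_{q\in\mathbb N}\left(qx+\|qw\|\right)$ for $x>0$.
   Context: A strictly convex $\mathcal C^2$ curve is the image $\Gamma$ of a $\mathcal C^2$ map $\gamma=(x,y):[0,1]\to\mathbb R^2$ such that $x'y''-x''y'$ never vanishes. Applying an isometry of $\mathbb R^2$ preserving $\mathbb Z^2$ (a composition of reflections in the coordinate axes and in the lines $y=\pm x$), one may assume $0\le y'(0)\le x'(0)$; for such normalized curves set $w(\Gamma)=y'(0)/x'(0)\in[0,1]$ (the initial slope). The radius of curvature at $\gamma(t)$ is $r(t)=(x'^2+y'^2)^{3/2}/|x'y''-x''y'|$, and $r(\Gamma)=\min_{t\in[0,1]}r(t)$. $\ell(\Gamma)$ is the length of $\Gamma$ and $N(\Gamma)=|\Gamma\cap\mathbb Z^2|$. $N_{w,\ell,r}$ denotes the maximum of $N(\Gamma)$ over all such (normalized) curves $\Gamma$ with $\ell(\Gamma)=\ell$, $r(\Gamma)=r$, $w(\Gamma)=w$. For real $x$, $\|x\|$ is the distance from $x$ to the nearest integer; $\mathbb N=\{1,2,\dots\}$. *)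

(* Defs.v *)
From Stdlib Require Import Reals Lra Lia ZArith Ensembles Finite_sets.
From Coquelicot Require Import Coquelicot.
Open Scope R_scope.

Definition is_min (E : R -> Prop) (m : R) : Prop :=
  E m /\ forall v, E v -> m <= v.

Definition inf_set (E : R -> Prop) : R := real (Glb_Rbar E).

Lemma is_min_inf_set (E : R -> Prop) (m : R) : is_min E m -> inf_set E = m.
Proof.
intros [Em lb]. unfold inf_set.
rewrite (is_glb_Rbar_unique E m); [reflexivity|].
split; [intros v Ev; exact (lb v Ev)|].
intros b Hb; exact (Hb m Em).
Qed.

Definition I01 (t : R) : Prop := 0 <= t <= 1.

(* A strictly convex C^2 parametrization on [0,1].  Derivatives are relative to
   [0,1] (one-sided at the endpoints), hence uniquely determined there; values
   outside [0,1] are irrelevant. *)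
Record curve := Curve {
  cx : R -> R;  cy : R -> R;
  cx' : R -> R; cy' : R -> R;
  cx'' : R -> R; cy'' : R -> R;
  cx_D1 : forall t, I01 t -> D_in cx cx' I01 t;
  cy_D1 : forall t, I01 t -> D_in cy cy' I01 t;
  cx_D2 : forall t, I01 t -> D_in cx' cx'' I01 t;
  cy_D2 : forall t, I01 t -> D_in cy' cy'' I01 t;
  cx_C2 : forall t, I01 t -> continue_in cx'' I01 t;
  cy_C2 : forall t, I01 t -> continue_in cy'' I01 t;
  curve_convex : forall t, I01 t -> cx' t * cy'' t - cx'' t * cy' t <> 0
}.

(* Convexity makes [cx' t ^ 2 + cy' t ^ 2] positive on [0,1], where [Rpower] is
   the genuine real power. *)
Definition curvature_radius (G : curve) (t : R) : R :=
  Rpower (cx' G t ^ 2 + cy' G t ^ 2) (3 / 2)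
  / Rabs (cx' G t * cy'' G t - cx'' G t * cy' G t).

Definition is_min_radius (G : curve) (r : R) : Prop :=
  is_min (fun v => exists t, I01 t /\ v = curvature_radius G t) r.

(* Length of the parametrization.  When it does not exceed the minimal radius of
   curvature, the tangent turns by at most 1 radian, so the parametrization is
   injective and this is the length of the image. *)
Definition curve_length (G : curve) : R :=
  RInt (fun t => sqrt (cx' G t ^ 2 + cy' G t ^ 2)) 0 1.

(* Together with convexity at 0, this forces [0 < cx' G 0]. *)
Definition normalized (G : curve) : Prop := 0 <= cy' G 0 <= cx' G 0.

Definition initial_slope (G : curve) : R := cy' G 0 / cx' G 0.

Definition lattice_points (G : curve) : Ensemble (Z * Z) :=
  fun p => exists t, I01 t /\ cx G t = IZR (fst p) /\ cy G t = IZR (snd p).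

Definition in_class (w l r : R) (G : curve) : Prop :=
  normalized G /\ curve_length G = l /\ is_min_radius G r /\ initial_slope G = w.

Definition is_max_lattice_points (w l r : R) (N : nat) : Prop :=
  (exists G, in_class w l r G /\ cardinal (Z * Z) (lattice_points G) N) /\
  (forall G, in_class w l r G ->
     exists n, cardinal (Z * Z) (lattice_points G) n /\ (n <= N)%nat).

Definition dist_int_values (x : R) : R -> Prop :=
  fun v => exists n : Z, v = Rabs (x - IZR n).

Definition dist_int (x : R) : R := inf_set (dist_int_values x).

Definition delta_values (w x : R) : R -> Prop :=
  fun v => exists q : nat, (1 <= q)%nat /\ v = INR q * x + dist_int (INR q * w).

Definition delta (w x : R) : R := inf_set (delta_values w x).

Lemma dist_int_min (x : R) : is_min (dist_int_values x) (dist_int x).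
Proof.
assert (H : exists m, is_min (dist_int_values x) m).
{ destruct (base_Int_part x) as [H1 H2].
  set (k := Int_part x) in *.
  assert (Hlb : forall n : Z,
     Rmin (x - IZR k) (IZR k + 1 - x) <= Rabs (x - IZR n)).
  { intro n. destruct (Z_le_gt_dec n k) as [h|h].
    - apply IZR_le in h. rewrite Rabs_pos_eq by lra.
      eapply Rle_trans; [apply Rmin_l | lra].
    - assert (h' : (k + 1 <= n)%Z) by lia.
      apply IZR_le in h'. rewrite plus_IZR in h'.
      rewrite Rabs_left1 by lra.
      eapply Rle_trans; [apply Rmin_r | lra]. }
  exists (Rmin (x - IZR k) (IZR k + 1 - x)). split.
  - unfold Rmin; destruct Rle_dec.
    + exists k. rewrite Rabs_pos_eq; lra.
    + exists (k + 1)%Z. rewrite plus_IZR, Rabs_left1; lra.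
  - intros v [n ->]. apply Hlb. }
destruct H as [m Hm]. unfold dist_int.
now rewrite (is_min_inf_set _ _ Hm).
Qed.

Lemma dist_int_ge0 (x : R) : 0 <= dist_int x.
Proof.
destruct (dist_int_min x) as [[n Hn] _]. rewrite Hn. apply Rabs_pos.
Qed.

Lemma delta_min (w x : R) : 0 < x -> is_min (delta_values w x) (delta w x).
Proof.
intro x0.
set (f := fun q => INR q * x + dist_int (INR q * w)).
assert (Hfin : forall n, exists q, (1 <= q)%nat /\
   forall p, (1 <= p <= S n)%nat -> f q <= f p).
{ induction n as [|n [q [q1 Hq]]].
  - exists 1%nat. split; [lia|]. intros p Hp.
    replace p with 1%nat by lia. lra.
  - destruct (Rle_dec (f q) (f (S (S n)))) as [h|h].
    + exists q. split; [exact q1|]. intros p Hp.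
      destruct (Nat.eq_dec p (S (S n))) as [->|]; [exact h | apply Hq; lia].
    + exists (S (S n)). split; [lia|]. intros p Hp.
      destruct (Nat.eq_dec p (S (S n))) as [->|]; [lra|].
      assert (f q <= f p) by (apply Hq; lia). lra. }
destruct (nfloor_ex (f 1%nat / x)) as [n [_ Hn]].
{ unfold Rdiv. apply Rmult_le_pos; [|left; now apply Rinv_0_lt_compat].
  unfold f. generalize (dist_int_ge0 (INR 1 * w)). simpl. lra. }
destruct (Hfin n) as [q [q1 Hq]].
assert (Hm : is_min (delta_values w x) (f q)).
{ split; [now exists q|].
  intros v [p [p1 ->]]. change (f q <= f p).
  destruct (le_lt_dec p (S n)) as [h|h]; [apply Hq; lia|].
  assert (f q <= f 1%nat) by (apply Hq; lia).
  assert (hp : INR n + 1 <= INR p).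
  { rewrite <- S_INR. apply le_INR. lia. }
  assert (f 1%nat <= INR p * x).
  { apply Rmult_le_reg_r with (/ x); [now apply Rinv_0_lt_compat|].
    unfold Rdiv in Hn. rewrite Rmult_assoc, Rinv_r by lra. lra. }
  generalize (dist_int_ge0 (INR p * w)). unfold f in *. lra. }
unfold delta. now rewrite (is_min_inf_set _ _ Hm).
Qed.

(* Main.v *)
Require Import Defs.
From Stdlib Require Import Reals Lra Lia ZArith Ensembles Finite_sets Classical ClassicalEpsilon.
From Stdlib Require Import FunctionalExtensionality PropExtensionality.
From Stdlib Require Import List Permutation Sorted.
From Coquelicot Require Import Coquelicot.
Import ListNotations.
Open Scope R_scope.

(** Upper bound.  Since the tangent direction moves by at most [l / r], three lattice
    points on an arc of length [s] span a nonzero integral area at most [2 s ^ 3 / r], so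
    [s >= (r / 2) ^ (1 / 3)].  On the other hand, if [q x + |q w - p|] realizes
    [delta w x] with [x = l / r], the form [q Y - p X] varies by at most [3 l delta] along
    the curve, and each of its level lines meets the curve at most twice.

    Lower bound.  The curve is a graph with [f' 0 = w] and [0 < f'' <= f'' 0]; as [f' >= w],
    its curvature is maximal at [0], and its length is adjusted at the right end.  Given
    fractions [s_1 < ... < s_n] in [(w, w + x / 18]] with denominators at most [A], [f] has
    slope [s_i] at a lattice point [P_i], and [P_{i+1} - P_i] is a combination of the
    primitive vectors of slopes [s_i], [s_{i+1}] balanced so that the chord slope is near
    the middle of [[s_i, s_{i+1}]]; horizontal lengths [O(A + r (s_{i+1} - s_i))] are enough
    for [f'' <= 1 / r], so [n] of order [l / A] is possible.  Geometry of numbers provides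
    [c x A ^ 2] such fractions as soon as [A >= C / delta w x], and one takes
    [A = C max (r ^ (1 / 3), 1 / delta w x)]. *)

(** The exponent 1/3 in the lower bound comes from comparing two counts: about [x * A ^ 2] fractions
    are available, about [l / A] can be used, and with [x = l / r] the first exceeds the second once
    [A ^ 3] is a large multiple of [r]. The term [1 / delta w x] is the scale of [A] below which a
    short interval to the right of [w] may hold too few fractions of denominator at most [A]. The
    obstacle is that length, minimal radius and initial slope are prescribed exactly, so smoothing a
    convex polygon would not do. Here [f''] takes at [0] the value fixed by [r] and [w], and has
    fallen to a tiny constant [eps] at the first lattice point; each further lattice point is bought
    by two bumps of [f''] on this background, never higher than [f'' 0]. Beyond the last point the
    background alone keeps the curve strictly convex, so it can be prolonged until its length is
    [l]. As the first lattice point sits at a real abscissa [d], the graph is finally translated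
    horizontally by [- d]. *)

Lemma is_derive_Rplus (f g : R -> R) (x a b : R) :
  is_derive f x a -> is_derive g x b -> is_derive (fun t => f t + g t) x (a + b).
Proof. exact (is_derive_plus f g x a b). Qed.

Lemma is_derive_Rminus (f g : R -> R) (x a b : R) :
  is_derive f x a -> is_derive g x b -> is_derive (fun t => f t - g t) x (a - b).
Proof. exact (is_derive_minus f g x a b). Qed.

Lemma is_derive_Ropp (f : R -> R) (x a : R) :
  is_derive f x a -> is_derive (fun t => - f t) x (- a).
Proof. exact (is_derive_opp f x a). Qed.

Lemma is_derive_Rscal (f : R -> R) (c x a : R) :
  is_derive f x a -> is_derive (fun t => c * f t) x (c * a).
Proof. exact (is_derive_scal f x c a). Qed.

Lemma continuous_Rminus (f g : R -> R) (x : R) :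
  continuous f x -> continuous g x -> continuous (fun t => f t - g t) x.
Proof. exact (continuous_minus f g x). Qed.

(** Mean value theorem for [G - F]. The majorant is a function rather than a constant because below
    it is a multiple of arclength: this replaces a reparametrization by arclength. *)
Lemma increment_le (F G F' G' : R -> R) (u t : R) :
  u <= t ->
  (forall z, u <= z <= t -> is_derive F z (F' z)) ->
  (forall z, u <= z <= t -> is_derive G z (G' z)) ->
  (forall z, u <= z <= t -> F' z <= G' z) ->
  F t - F u <= G t - G u.
Proof.
intros ut dF dG le.
destruct (MVT_gen (fun z => G z - F z) u t (fun z => G' z - F' z)) as [c [hc e]].
- intros z hz. rewrite Rmin_left, Rmax_right in hz by lra.
  apply is_derive_Rminus; [apply dG | apply dF]; lra.
- intros z hz. rewrite Rmin_left, Rmax_right in hz by lra.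
  apply continuity_pt_filterlim. apply (ex_derive_continuous (fun z => G z - F z)).
  exists (G' z - F' z).
  apply is_derive_Rminus; [apply dG | apply dF]; lra.
- rewrite Rmin_left, Rmax_right in hc by lra.
  assert (0 <= (G' c - F' c) * (t - u)).
  { apply Rmult_le_pos; [specialize (le c hc)|]; lra. }
  lra.
Qed.

Lemma increment_Rabs_le (F G F' G' : R -> R) (u t : R) :
  u <= t ->
  (forall z, u <= z <= t -> is_derive F z (F' z)) ->
  (forall z, u <= z <= t -> is_derive G z (G' z)) ->
  (forall z, u <= z <= t -> Rabs (F' z) <= G' z) ->
  Rabs (F t - F u) <= G t - G u.
Proof.
intros ut dF dG le. apply Rabs_le. split.
- assert (h : (fun z => - F z) t - (fun z => - F z) u <= G t - G u).
  { apply (increment_le (fun z => - F z) G (fun z => - F' z) G' u t); auto.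
    - intros z hz. apply is_derive_Ropp. now apply dF.
    - intros z hz. specialize (le z hz). apply Rabs_le_between in le. lra. }
  simpl in h. lra.
- apply (increment_le F G F' G' u t); auto.
  intros z hz. specialize (le z hz). apply Rabs_le_between in le. lra.
Qed.

(** * Extension of a curve from [0,1] to the whole line *)

Definition clamp01 (t : R) : R := Rmax 0 (Rmin 1 t).

Lemma clamp01_I01 (t : R) : I01 (clamp01 t).
Proof. unfold clamp01, I01, Rmax, Rmin; repeat destruct Rle_dec; lra. Qed.

Lemma clamp01_id (t : R) : I01 t -> clamp01 t = t.
Proof. unfold clamp01, I01, Rmax, Rmin; repeat destruct Rle_dec; lra. Qed.

Lemma clamp01_lip (s t : R) : Rabs (clamp01 s - clamp01 t) <= Rabs (s - t).
Proof.
unfold clamp01, Rmax, Rmin; repeat destruct Rle_dec;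
  unfold Rabs; repeat destruct Rcase_abs; lra.
Qed.

Lemma continuous_comp_clamp01 (f : R -> R) :
  (forall t, I01 t -> continue_in f I01 t) ->
  forall t, continuous (fun s => f (clamp01 s)) t.
Proof.
intros cf t. apply continuity_pt_filterlim.
intros e he.
destruct (cf (clamp01 t) (clamp01_I01 t) e he) as [d [hd H]].
exists d. split; [exact hd|]. intros s [_ hs].
(* The limit in [continue_in] leaves out the base point, but [clamp01] can send [s] onto it; the
   values then coincide. *)
destruct (Req_dec (clamp01 s) (clamp01 t)) as [E|N].
- rewrite E. unfold dist; simpl. rewrite R_dist_eq. exact he.
- apply H. split.
  + split; [apply clamp01_I01 | intro; apply N; auto].
  + unfold dist in *; simpl in *. unfold R_dist in *.
    eapply Rle_lt_trans; [apply clamp01_lip | exact hs].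
Qed.

Lemma D_in_I01_interior (f f' : R -> R) (t : R) :
  D_in f f' I01 t -> 0 < t < 1 -> is_derive f t (f' t).
Proof.
intros H ht. apply is_derive_Reals. apply derivable_pt_lim_D_in.
intros e he. destruct (H e he) as [d [hd Hd]].
exists (Rmin d (Rmin t (1 - t))). split.
- repeat apply Rmin_glb_lt; lra.
- intros z [[_ nz] hz]. apply Hd. split; [split; [|exact nz]|].
  + simpl in hz. unfold R_dist in hz.
    pose proof (Rmin_r d (Rmin t (1 - t))). pose proof (Rmin_l t (1 - t)).
    pose proof (Rmin_r t (1 - t)).
    assert (hz' : Rabs (z - t) < Rmin t (1 - t)) by lra.
    apply Rabs_lt_between in hz'. unfold I01; lra.
  + eapply Rlt_le_trans; [exact hz | apply Rmin_l].
Qed.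

Lemma continuous_primitive (g : R -> R) (a : R) :
  (forall t, continuous g t) -> forall t, is_derive (fun t => RInt g a t) t (g t).
Proof.
intros cg t. apply (is_derive_RInt g _ a).
- apply filter_forall. intro u. apply @RInt_correct.
  apply ex_RInt_continuous. intros; apply cg.
- apply cg.
Qed.

(* The one-sided derivatives at the endpoints enter only through continuity: the
   difference with a global primitive has zero derivative inside, so is constant. *)
Lemma primitive_extension (f f' g : R -> R) :
  (forall t, I01 t -> D_in f f' I01 t) ->
  (forall t, continuous g t) -> (forall t, I01 t -> g t = f' t) ->
  exists F, (forall t, is_derive F t (g t)) /\ (forall t, I01 t -> F t = f t).
Proof.
intros Df cg E.
set (F := fun t => f 0 + RInt g 0 t).
assert (dF : forall t, is_derive F t (g t)).
{ intro t. unfold F. evar_last.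
  apply is_derive_Rplus.
  - apply (is_derive_const (V := R_NormedModule)).
  - apply (continuous_primitive g 0 cg t).
  - apply Rplus_0_l. }
exists F. split; [exact dF|].
assert (cD : forall t, continuous (fun z => F z - f (clamp01 z)) t).
{ intro t. apply continuous_Rminus.
  - apply (ex_derive_continuous F). exists (g t); apply dF.
  - apply continuous_comp_clamp01. intros z hz. apply cont_deriv with f'. now apply Df. }
intros t ht.
destruct (MVT_gen (fun z => F z - f (clamp01 z)) 0 t (fun _ => 0)) as [c [_ e]].
- unfold I01 in ht. intros z hz. rewrite Rmin_left, Rmax_right in hz by lra.
  assert (hz' : 0 < z < 1) by lra.
  evar_last.
  + apply is_derive_Rminus; [apply dF|].
    apply (is_derive_ext_loc f).
    * assert (L : locally z (fun y => 0 < y /\ y < 1)).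
      { apply filter_and; [apply (open_gt 0); lra | apply (open_lt 1); lra]. }
      revert L. apply filter_imp. intros y hy. rewrite clamp01_id; [reflexivity|unfold I01; lra].
    * apply D_in_I01_interior; [apply Df; unfold I01; lra | exact hz'].
  + rewrite E by (unfold I01; lra). apply Rminus_diag.
- intros z _. apply continuity_pt_filterlim. apply cD.
- rewrite !clamp01_id in e by (unfold I01 in *; lra).
  unfold F in e at 2. rewrite RInt_point in e. unfold zero in e; simpl in e. lra.
Qed.

Record smooth_plane_curve (G : curve) (X Y X1 Y1 X2 Y2 : R -> R) : Prop := {
  spc_X : forall t, is_derive X t (X1 t);
  spc_Y : forall t, is_derive Y t (Y1 t);
  spc_X1 : forall t, is_derive X1 t (X2 t);
  spc_Y1 : forall t, is_derive Y1 t (Y2 t);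
  spc_agree : forall t, I01 t ->
    X t = cx G t /\ Y t = cy G t /\ X1 t = cx' G t /\ Y1 t = cy' G t /\
    X2 t = cx'' G t /\ Y2 t = cy'' G t }.

(** The second derivatives are extended by constants, through [clamp01], then integrated twice;
    [primitive_extension] fixes the constants of integration. *)
Lemma smooth_plane_curve_exists (G : curve) :
  exists X Y X1 Y1 X2 Y2, smooth_plane_curve G X Y X1 Y1 X2 Y2.
Proof.
assert (ext : forall f f' f'' : R -> R,
  (forall t, I01 t -> D_in f f' I01 t) -> (forall t, I01 t -> D_in f' f'' I01 t) ->
  (forall t, I01 t -> continue_in f'' I01 t) ->
  exists F F1 F2, (forall t, is_derive F t (F1 t)) /\ (forall t, is_derive F1 t (F2 t)) /\
   forall t, I01 t -> F t = f t /\ F1 t = f' t /\ F2 t = f'' t).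
{ intros f f' f'' D1 D2 C2.
  destruct (primitive_extension f' f'' (fun t => f'' (clamp01 t)) D2) as [F1 [d1 e1]].
  - now apply continuous_comp_clamp01.
  - intros t ht. cbv beta. now rewrite clamp01_id.
  - destruct (primitive_extension f f' F1 D1) as [F [d e]].
    + intro t. apply (ex_derive_continuous F1). eexists; apply d1.
    + exact e1.
    + exists F, F1, (fun t => f'' (clamp01 t)). split; [exact d | split; [exact d1|]].
      intros t ht. cbv beta. rewrite clamp01_id by exact ht. auto. }
destruct (ext _ _ _ (cx_D1 G) (cx_D2 G) (cx_C2 G)) as [X [X1 [X2 [a [b c]]]]].
destruct (ext _ _ _ (cy_D1 G) (cy_D2 G) (cy_C2 G)) as [Y [Y1 [Y2 [a' [b' c']]]]].
exists X, Y, X1, Y1, X2, Y2. split; auto.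
intros t ht. destruct (c t ht) as [? [? ?]], (c' t ht) as [? [? ?]]. tauto.
Qed.

(** * Turning of the tangent *)

Section TurningBound.

Context (X Y X1 Y1 X2 Y2 : R -> R) (r l : R).
Context (dX : forall t, is_derive X t (X1 t)) (dY : forall t, is_derive Y t (Y1 t)).
Context (dX1 : forall t, is_derive X1 t (X2 t)) (dY1 : forall t, is_derive Y1 t (Y2 t)).

Let v (t : R) := sqrt (X1 t ^ 2 + Y1 t ^ 2).
Let det (t : R) := X1 t * Y2 t - X2 t * Y1 t.
Let s (t : R) : R := RInt v 0 t.
Let T1 (t : R) := X1 t / v t.
Let T2 (t : R) := Y1 t / v t.

Context (det_neq0 : forall t, I01 t -> det t <> 0).
(** Curvature at most [1 / r], cleared of its denominator. With [length_le] the tangent turns by at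
    most one radian in all. *)
Context (det_le : forall t, I01 t -> Rabs (det t) <= v t ^ 3 / r).
Context (r_gt0 : 0 < r) (length_le : s 1 <= r).

Lemma speed_sqr t : v t ^ 2 = X1 t ^ 2 + Y1 t ^ 2.
Proof. unfold v. rewrite pow2_sqrt; nra. Qed.

Lemma speed_gt0 t : I01 t -> 0 < v t.
Proof.
intro ht. apply sqrt_lt_R0. specialize (det_neq0 t ht). unfold det in det_neq0.
destruct (Req_dec (X1 t) 0) as [e|]; [destruct (Req_dec (Y1 t) 0) as [e'|]|]; try nra.
Qed.

Lemma continuous_speed t : continuous v t.
Proof.
apply continuity_pt_filterlim. apply (continuity_pt_comp (fun t => X1 t ^ 2 + Y1 t ^ 2) sqrt).
- apply continuity_pt_filterlim. apply (ex_derive_continuous (fun t => X1 t ^ 2 + Y1 t ^ 2)).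
  auto_derive. repeat split; eexists; [apply dX1 | apply dY1].
- apply continuity_pt_sqrt. nra.
Qed.

Lemma is_derive_arclength t : is_derive s t (v t).
Proof. apply (continuous_primitive v 0 continuous_speed). Qed.

Lemma arclength_increment_ge0 u t : u <= t -> 0 <= s t - s u.
Proof.
intro ut. pose proof (increment_le (fun _ => 0) s (fun _ => 0) v u t ut) as H.
simpl in H. rewrite Rminus_diag in H. apply H.
- intros. apply (is_derive_const (V := R_NormedModule)).
- intros; apply is_derive_arclength.
- intros; apply sqrt_pos.
Qed.

Lemma arclength_increment_le u t : I01 u -> I01 t -> s t - s u <= s 1.
Proof.
intros [? ?] [? ?].
pose proof (arclength_increment_ge0 t 1). pose proof (arclength_increment_ge0 0 u).
assert (s 0 = 0) by (unfold s; rewrite RInt_point; reflexivity). lra.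
Qed.

Lemma tangent_unit t : I01 t -> T1 t ^ 2 + T2 t ^ 2 = 1.
Proof.
intro ht. pose proof (speed_gt0 t ht). unfold T1, T2.
replace ((X1 t / v t) ^ 2 + (Y1 t / v t) ^ 2) with ((X1 t ^ 2 + Y1 t ^ 2) / v t ^ 2) by (field; lra).
rewrite <- speed_sqr. field; lra.
Qed.

(** Frenet formula: [det / v ^ 3] is the signed curvature and [(- Y1, X1)] the velocity turned by a
    right angle. Testing against a fixed vector [(a, b)] covers at once all projections of the
    tangent needed below. *)
Lemma is_derive_tangent_form a b t : I01 t ->
  is_derive (fun t => a * T1 t + b * T2 t) t (det t / v t ^ 3 * (b * X1 t - a * Y1 t)).
Proof.
intro ht. pose proof (speed_gt0 t ht) as vp. pose proof (speed_sqr t) as vs.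
assert (0 < X1 t ^ 2 + Y1 t ^ 2) by (rewrite <- vs; nra).
unfold T1, T2, v. auto_derive.
- assert (eX : ex_derive (fun x => X1 x) t) by (eexists; apply dX1).
  assert (eY : ex_derive (fun x => Y1 x) t) by (eexists; apply dY1).
  assert (v t <> 0) by lra.
  replace (X1 t * (X1 t * 1) + Y1 t * (Y1 t * 1)) with (X1 t ^ 2 + Y1 t ^ 2) by ring.
  fold (v t). tauto.
- replace (Derive (fun x => X1 x) t) with (X2 t) by (symmetry; apply is_derive_unique; apply dX1).
  replace (Derive (fun x => Y1 x) t) with (Y2 t) by (symmetry; apply is_derive_unique; apply dY1).
  replace (X1 t * (X1 t * 1) + Y1 t * (Y1 t * 1)) with (X1 t ^ 2 + Y1 t ^ 2) by ring.
  fold (v t). unfold det. field_simplify; try lra.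
  replace (v t ^ 2) with (X1 t ^ 2 + Y1 t ^ 2) by auto.
  apply Rmult_eq_reg_r with (v t ^ 3); [|apply pow_nonzero; lra].
  field_simplify; try lra.
Qed.

Lemma Rabs_cross_le a b c x y : 0 <= c -> a ^ 2 + b ^ 2 <= c ^ 2 ->
  Rabs (b * x - a * y) <= c * sqrt (x ^ 2 + y ^ 2).
Proof.
intros hc h. rewrite <- (Rabs_pos_eq (c * sqrt (x ^ 2 + y ^ 2))).
2: apply Rmult_le_pos; [exact hc | apply sqrt_pos].
apply Rsqr_le_abs_0. rewrite Rsqr_mult, Rsqr_sqrt by nra. unfold Rsqr.
assert (0 <= (c ^ 2 - (a ^ 2 + b ^ 2)) * (x ^ 2 + y ^ 2)) by (apply Rmult_le_pos; nra).
assert (0 <= (a * x + b * y) ^ 2) by apply pow2_ge_0. nra.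
Qed.

(** By the Frenet formula and Cauchy-Schwarz the form changes at rate at most [c * v / r]. Later
    [(a, b)] is the normal at [u], the tangent at [u], or [(- p, q)]. *)
Lemma tangent_form_increment a b c u t :
  I01 u -> I01 t -> u <= t -> 0 <= c -> a ^ 2 + b ^ 2 <= c ^ 2 ->
  Rabs ((a * T1 t + b * T2 t) - (a * T1 u + b * T2 u)) <= c / r * (s t - s u).
Proof.
intros hu ht ut hc h.
replace (c / r * (s t - s u)) with (c / r * s t - c / r * s u) by ring.
unfold I01 in *.
apply (increment_Rabs_le (fun t => a * T1 t + b * T2 t) (fun t => c / r * s t)
   (fun t => det t / v t ^ 3 * (b * X1 t - a * Y1 t)) (fun t => c / r * v t) u t ut).
- intros z hz. apply is_derive_tangent_form. unfold I01; lra.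
- intros z hz. apply is_derive_Rscal, is_derive_arclength.
- intros z hz. assert (hz' : I01 z) by (unfold I01; lra).
  pose proof (speed_gt0 z hz') as vp. assert (0 < v z ^ 3) by (apply pow_lt; lra).
  rewrite Rabs_mult.
  replace (c / r * v z) with (/ r * (c * v z)) by (field; lra).
  apply Rmult_le_compat; try apply Rabs_pos.
  + unfold Rdiv. rewrite Rabs_mult, Rabs_inv, (Rabs_pos_eq (v z ^ 3)) by lra.
    apply Rmult_le_reg_r with (v z ^ 3); [lra|].
    specialize (det_le z hz'). replace (/ r * v z ^ 3) with (v z ^ 3 / r) by (field; lra).
    rewrite Rmult_assoc, Rinv_l by lra. lra.
  + apply Rabs_cross_le; assumption.
Qed.

Lemma tangent_cross_le u t : I01 u -> I01 t -> u <= t ->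
  Rabs (T1 u * T2 t - T2 u * T1 t) <= (s t - s u) / r.
Proof.
intros hu ht ut.
pose proof (tangent_form_increment (- T2 u) (T1 u) 1 u t hu ht ut) as H.
pose proof (tangent_unit u hu).
replace ((- T2 u * T1 t + T1 u * T2 t) - (- T2 u * T1 u + T1 u * T2 u))
  with (T1 u * T2 t - T2 u * T1 t) in H by ring.
replace ((s t - s u) / r) with (1 / r * (s t - s u)) by (field; lra).
apply H; nra.
Qed.

Lemma tangent_dot_ge u t : I01 u -> I01 t -> u <= t ->
  1 - (s t - s u) / r <= T1 u * T1 t + T2 u * T2 t.
Proof.
intros hu ht ut.
pose proof (tangent_form_increment (T1 u) (T2 u) 1 u t hu ht ut) as H.
pose proof (tangent_unit u hu) as Hu.
replace (T1 u * T1 u + T2 u * T2 u) with 1 in H by (rewrite <- Hu; ring).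
assert (H' : Rabs (T1 u * T1 t + T2 u * T2 t - 1) <= 1 / r * (s t - s u)) by (apply H; nra).
apply Rabs_le_between in H'. unfold Rdiv in *. lra.
Qed.

Lemma arclength_increment_gt0 u t : I01 u -> I01 t -> u < t -> 0 < s t - s u.
Proof.
intros [? ?] [? ?] ut.
destruct (MVT_cor2 s v u t ut) as [c [e hc]].
- intros c _. apply is_derive_Reals, is_derive_arclength.
- rewrite e. apply Rmult_lt_0_compat; [|lra]. apply speed_gt0; unfold I01; lra.
Qed.

(** The cross product with the tangent at [u] vanishes at [u], and its derivative is curvature times
    speed times the dot product of the tangents at [u] and at the current point; none of these
    factors vanishes. *)
Lemma tangent_cross_neq0 u t : I01 u -> I01 t -> u < t ->
  T1 u * T2 t - T2 u * T1 t <> 0.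
Proof.
intros hu ht ut E.
destruct (MVT_cor2 (fun t => - T2 u * T1 t + T1 u * T2 t)
   (fun t => det t / v t ^ 3 * (T1 u * X1 t - - T2 u * Y1 t)) u t ut) as [c [e hc]].
- intros c hc. apply is_derive_Reals, is_derive_tangent_form. unfold I01 in *; lra.
- assert (hc' : I01 c) by (unfold I01 in *; lra).
  pose proof (speed_gt0 c hc') as vp. pose proof (det_neq0 c hc').
  pose proof (tangent_dot_ge u c hu hc' ltac:(lra)) as d.
  assert (0 < T1 u * T1 c + T2 u * T2 c).
  (* Strict even when the whole length equals [r], because the mean value point [c] lies before
     [t]. *)
  { assert (s c - s u < r).
    { pose proof (arclength_increment_gt0 c t hc' ht ltac:(lra)).
      pose proof (arclength_increment_le u t hu ht). lra. }
    assert ((s c - s u) / r < 1).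
    { apply Rmult_lt_reg_r with r; [lra|]. unfold Rdiv.
      rewrite Rmult_assoc, Rinv_l by lra. lra. }
    lra. }
  replace (- T2 u * T1 t + T1 u * T2 t - (- T2 u * T1 u + T1 u * T2 u)) with 0 in e by (rewrite <- E; ring).
  replace (T1 u * X1 c - - T2 u * Y1 c) with ((T1 u * T1 c + T2 u * T2 c) * v c) in e
    by (unfold T1 at 2, T2 at 2; field; lra).
  symmetry in e. apply Rmult_integral in e. destruct e as [e|e]; [|lra].
  apply Rmult_integral in e. destruct e as [e|e]; [|nra].
  assert (v c ^ 3 <> 0) by (apply pow_nonzero; lra).
  apply (Rmult_eq_compat_r (v c ^ 3)) in e. unfold Rdiv in e.
  rewrite Rmult_assoc, Rinv_l in e by lra. lra.
Qed.

(** Rolle's theorem between consecutive points gives two parameters with tangents parallel to the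
    line, contrary to [tangent_cross_neq0]. *)
Lemma line_meets_at_most_twice p q t1 t2 t3 :
  I01 t1 -> I01 t3 -> t1 < t2 < t3 -> p <> 0 \/ q <> 0 ->
  q * Y t1 - p * X t1 = q * Y t2 - p * X t2 ->
  q * Y t2 - p * X t2 = q * Y t3 - p * X t3 -> False.
Proof.
intros h1 h3 [h12 h23] pq e12 e23.
assert (dL : forall c, derivable_pt_lim (fun t => q * Y t - p * X t) c (q * Y1 c - p * X1 c)).
{ intro c. apply is_derive_Reals, is_derive_Rminus; apply is_derive_Rscal; auto. }
assert (rolle : forall a b, a < b -> q * Y a - p * X a = q * Y b - p * X b ->
   exists c, a < c < b /\ q * Y1 c - p * X1 c = 0).
{ intros a b ab e.
  destruct (MVT_cor2 _ (fun c => q * Y1 c - p * X1 c) a b ab (fun c _ => dL c)) as [c [h hc]].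
  exists c. split; [exact hc|]. rewrite <- e, Rminus_diag in h. symmetry in h.
  apply Rmult_integral in h. destruct h; lra. }
destruct (rolle t1 t2 h12 e12) as [u [hu eu]], (rolle t2 t3 h23 e23) as [w [hw ew]].
unfold I01 in *. assert (iu : I01 u) by (unfold I01; lra). assert (iw : I01 w) by (unfold I01; lra).
apply (tangent_cross_neq0 u w iu iw); [lra|].
pose proof (speed_gt0 u iu). pose proof (speed_gt0 w iw).
assert (E : X1 u * Y1 w - Y1 u * X1 w = 0).
{ destruct pq as [h|h].
  - apply Rmult_eq_reg_l with p; [|exact h].
    replace (p * (X1 u * Y1 w - Y1 u * X1 w)) with ((p * X1 u) * Y1 w - Y1 u * (p * X1 w)) by ring.
    replace (p * X1 u) with (q * Y1 u) by lra. replace (p * X1 w) with (q * Y1 w) by lra. ring.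
  - apply Rmult_eq_reg_l with q; [|exact h].
    replace (q * (X1 u * Y1 w - Y1 u * X1 w)) with (X1 u * (q * Y1 w) - (q * Y1 u) * X1 w) by ring.
    replace (q * Y1 u) with (p * X1 u) by lra. replace (q * Y1 w) with (p * X1 w) by lra. ring. }
unfold T1, T2. replace (X1 u / v u * (Y1 w / v w) - Y1 u / v u * (X1 w / v w))
  with ((X1 u * Y1 w - Y1 u * X1 w) / (v u * v w)) by (field; lra).
rewrite E. unfold Rdiv; ring.
Qed.

(** Per unit of arclength the form changes by its value on the unit tangent, which differs from the
    initial one by at most [c * s 1 / r]. *)
Lemma linear_form_variation p q c u t :
  I01 u -> I01 t -> u <= t -> 0 <= c -> p ^ 2 + q ^ 2 <= c ^ 2 ->
  Rabs ((q * Y t - p * X t) - (q * Y u - p * X u))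
    <= (Rabs (q * T2 0 - p * T1 0) + c * s 1 / r) * (s t - s u).
Proof.
intros hu ht ut hc h. set (k := Rabs (q * T2 0 - p * T1 0) + c * s 1 / r).
rewrite Rmult_minus_distr_l. unfold I01 in *.
apply (increment_Rabs_le (fun t => q * Y t - p * X t) (fun t => k * s t)
  (fun t => q * Y1 t - p * X1 t) (fun t => k * v t) u t ut).
- intros z hz. apply is_derive_Rminus; apply is_derive_Rscal; auto.
- intros z hz. apply is_derive_Rscal, is_derive_arclength.
- intros z hz. assert (hz' : I01 z) by (unfold I01; lra).
  pose proof (speed_gt0 z hz') as vp.
  replace (q * Y1 z - p * X1 z) with ((q * T2 z - p * T1 z) * v z) by (unfold T1, T2; field; lra).
  rewrite Rabs_mult, (Rabs_pos_eq (v z)) by lra.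
  apply Rmult_le_compat_r; [lra|]. unfold k.
  assert (i0 : I01 0) by (unfold I01; lra).
  pose proof (tangent_form_increment (- p) q c 0 z i0 hz' ltac:(lra) hc ltac:(nra)) as H.
  replace (q * T2 z - p * T1 z) with
    ((q * T2 0 - p * T1 0) + ((- p * T1 z + q * T2 z) - (- p * T1 0 + q * T2 0))) by ring.
  eapply Rle_trans; [apply Rabs_triang|]. apply Rplus_le_compat_l.
  eapply Rle_trans; [exact H|].
  replace (c * s 1 / r) with (c / r * s 1) by (field; lra).
  apply Rmult_le_compat_l.
  + apply Rmult_le_pos; [lra|]. left; now apply Rinv_0_lt_compat.
  + apply arclength_increment_le; assumption.
Qed.

(** In the frame of the tangent and normal at [t1], the tangential coordinate [A] is at most [S] and
    the normal one [N] at most [S ^ 2 / r], since the normal component of the tangent is at most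
    [S / r]. The determinant is a difference of two products [A * N]. *)
Lemma triangle_area_le t1 t2 t3 :
  I01 t1 -> I01 t3 -> t1 <= t2 <= t3 ->
  Rabs ((X t2 - X t1) * (Y t3 - Y t1) - (Y t2 - Y t1) * (X t3 - X t1))
    <= 2 * (s t3 - s t1) ^ 3 / r.
Proof.
intros h1 h3 h. set (S := s t3 - s t1).
assert (S0 : 0 <= S) by (apply arclength_increment_ge0; lra).
set (A := fun t => T1 t1 * (X t - X t1) + T2 t1 * (Y t - Y t1)).
set (N := fun t => T1 t1 * (Y t - Y t1) - T2 t1 * (X t - X t1)).
pose proof (tangent_unit t1 h1) as U.
assert (B : forall a b c t, t1 <= t <= t3 -> 0 <= c ->
   (forall z, t1 <= z <= t -> Rabs (a * T1 z + b * T2 z) <= c) ->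
   Rabs (a * (X t - X t1) + b * (Y t - Y t1)) <= c * S).
{ intros a b c t ht hc H.
  replace (a * (X t - X t1) + b * (Y t - Y t1)) with ((a * X t + b * Y t) - (a * X t1 + b * Y t1)) by ring.
  apply Rle_trans with (c * s t - c * s t1).
  - apply (increment_Rabs_le (fun t => a * X t + b * Y t) (fun t => c * s t)
      (fun t => a * X1 t + b * Y1 t) (fun t => c * v t)); [lra| | |].
    + intros; apply is_derive_Rplus; apply is_derive_Rscal; auto.
    + intros; apply is_derive_Rscal, is_derive_arclength.
    + intros z hz. pose proof (speed_gt0 z ltac:(unfold I01 in *; lra)) as vp.
      replace (a * X1 z + b * Y1 z) with ((a * T1 z + b * T2 z) * v z) by (unfold T1, T2; field; lra).
      rewrite Rabs_mult, (Rabs_pos_eq (v z)) by lra.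
      apply Rmult_le_compat_r; [lra|]. now apply H.
  - rewrite <- Rmult_minus_distr_l. apply Rmult_le_compat_l; [exact hc|].
    unfold S. pose proof (arclength_increment_ge0 t t3). lra. }
assert (hA : forall t, t1 <= t <= t3 -> Rabs (A t) <= S).
{ intros t ht. rewrite <- (Rmult_1_l S). apply B; [exact ht|lra|].
  intros z hz. pose proof (tangent_unit z ltac:(unfold I01 in *; lra)) as Uz.
  apply Rabs_le.
  assert ((T1 t1 * T1 z + T2 t1 * T2 z) ^ 2 <= 1).
  { pose proof (pow2_ge_0 (T1 t1 * T2 z - T2 t1 * T1 z)).
    assert ((T1 t1 ^ 2 + T2 t1 ^ 2) * (T1 z ^ 2 + T2 z ^ 2) = 1) by (rewrite U, Uz; ring). nra. }
  nra. }
assert (hN : forall t, t1 <= t <= t3 -> Rabs (N t) <= S / r * S).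
{ intros t ht. unfold N.
  replace (T1 t1 * (Y t - Y t1) - T2 t1 * (X t - X t1))
    with ((- T2 t1) * (X t - X t1) + T1 t1 * (Y t - Y t1)) by ring.
  apply B; [exact ht| |].
  - apply Rmult_le_pos; [exact S0 | left; now apply Rinv_0_lt_compat].
  - intros z hz.
    pose proof (tangent_cross_le t1 z h1 ltac:(unfold I01 in *; lra) ltac:(lra)) as C.
    replace (- T2 t1 * T1 z + T1 t1 * T2 z) with (T1 t1 * T2 z - T2 t1 * T1 z) by ring.
    eapply Rle_trans; [exact C|]. apply Rmult_le_compat_r; [left; now apply Rinv_0_lt_compat|].
    unfold S. pose proof (arclength_increment_ge0 z t3). lra. }
replace ((X t2 - X t1) * (Y t3 - Y t1) - (Y t2 - Y t1) * (X t3 - X t1))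
  with ((T1 t1 ^ 2 + T2 t1 ^ 2) * ((X t2 - X t1) * (Y t3 - Y t1) - (Y t2 - Y t1) * (X t3 - X t1)))
  by (rewrite U; ring).
replace ((T1 t1 ^ 2 + T2 t1 ^ 2) * ((X t2 - X t1) * (Y t3 - Y t1) - (Y t2 - Y t1) * (X t3 - X t1)))
  with (A t2 * N t3 - N t2 * A t3) by (unfold A, N; ring).
eapply Rle_trans; [apply Rabs_triang|]. rewrite Rabs_Ropp, !Rabs_mult.
replace (2 * S ^ 3 / r) with (S * (S / r * S) + (S / r * S) * S) by (field; lra).
apply Rplus_le_compat; apply Rmult_le_compat; try apply Rabs_pos; auto; try apply hA; try apply hN; lra.
Qed.

End TurningBound.

(** * Counting lattice points on a curve of the class *)

(** Pigeonhole on the [K] possible keys. It serves twice: with arclength blocks, and with the values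
    of an integral linear form. *)
Lemma NoDup_length_le_twice_keys {T : Type} (key : T -> Z) (m : Z) (K : nat) (l : list T) :
  NoDup l ->
  (forall x, In x l -> (m <= key x < m + Z.of_nat K)%Z) ->
  (forall x y z, In x l -> In y l -> In z l -> x <> y -> y <> z -> x <> z ->
     key x = key y -> key y = key z -> False) ->
  (length l <= 2 * K)%nat.
Proof.
revert m l. induction K as [|K IH]; intros m l nd rng three.
- destruct l as [|x l]; [simpl; lia|]. specialize (rng x (or_introl eq_refl)). lia.
- set (f := fun x => Z.eqb (key x) m).
  assert (e : (length (filter f l) + length (filter (fun x => negb (f x)) l) = length l)%nat).
  { clear. induction l as [|x l IH]; [reflexivity|]. simpl. destruct (f x); simpl; lia. }
  assert (h1 : (length (filter f l) <= 2)%nat).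
  { assert (ndf := NoDup_filter f nd).
    assert (I : forall x, In x (filter f l) -> In x l /\ key x = m).
    { intros x hx. apply filter_In in hx. unfold f in hx. rewrite Z.eqb_eq in hx. exact hx. }
    destruct (filter f l) as [|x [|y [|z t]]]; simpl; try lia. exfalso.
    inversion ndf as [|? ? nx ndf']; subst. inversion ndf' as [|? ? ny ?]; subst.
    destruct (I x) as [? ?]; [simpl; tauto|]. destruct (I y) as [? ?]; [simpl; tauto|].
    destruct (I z) as [? ?]; [simpl; tauto|].
    apply (three x y z); auto; try congruence; intro; subst; simpl in *; tauto. }
  assert (h2 : (length (filter (fun x => negb (f x)) l) <= 2 * K)%nat).
  { apply (IH (m + 1)%Z).
    - now apply NoDup_filter.
    - intros x hx. apply filter_In in hx. destruct hx as [hx hf].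
      unfold f in hf. apply Bool.negb_true_iff, Z.eqb_neq in hf. specialize (rng x hx). lia.
    - intros x y z hx hy hz. apply filter_In in hx, hy, hz. apply three; tauto. }
  lia.
Qed.

Lemma NoDup_cardinal {T : Type} (P : Ensemble T) (l : list T) :
  NoDup l -> (forall x, P x <-> In x l) -> cardinal _ P (length l).
Proof.
revert P. induction l as [|a l IH]; intros P nd H.
- replace P with (Empty_set T); [constructor|].
  apply functional_extensionality; intro x. apply propositional_extensionality. split; intro hx; [destruct hx | apply H in hx; destruct hx].
- inversion nd as [|? ? na nd']; subst.
  replace P with (Ensembles.Add T (fun x => In x l) a).
  + simpl. apply card_add; [apply IH; tauto | exact na].
  + apply functional_extensionality; intro x. apply propositional_extensionality. split; intro hx.
    * apply H. destruct hx as [x hx | x hx]; [right; exact hx | left; destruct hx; reflexivity].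
    * apply H in hx. destruct hx as [<-|hx]; [right; constructor | left; exact hx].
Qed.

(** A duplicate-free list of elements of [P] is enlarged while some element is missing; the bound
    [B] stops this, [k] counting the room left. Finiteness of the lattice points thus comes with the
    counting bounds. *)
Lemma bounded_enumeration {T : Type} (P : Ensemble T) (B : nat) :
  (forall l : list T, NoDup l -> (forall x, In x l -> P x) -> (length l <= B)%nat) ->
  exists l : list T, NoDup l /\ forall x, P x <-> In x l.
Proof.
intro H.
assert (G : forall k (l : list T), NoDup l -> (forall x, In x l -> P x) -> (B <= length l + k)%nat ->
  exists l', NoDup l' /\ forall x, P x <-> In x l').
{ induction k as [|k IH]; intros l nd hl hB.
  - exists l. split; [exact nd|]. intro x. split; [|apply hl].
    intro px. apply NNPP. intro nx.
    assert (length (x :: l) <= B)%nat; [|simpl in *; lia].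
    apply H; [now constructor|]. intros y [<-|hy]; auto.
  - destruct (classic (forall x, P x -> In x l)) as [c|c].
    + exists l. split; [exact nd|]. firstorder.
    + apply not_all_ex_not in c. destruct c as [x c]. apply imply_to_and in c.
      destruct c as [px nx]. apply (IH (x :: l)).
      * now constructor.
      * intros y [<-|hy]; auto.
      * simpl; lia. }
apply (G B []); [constructor | intros x [] | simpl; lia].
Qed.

Lemma Rpower_3_2 (z : R) : 0 < z -> Rpower z (3 / 2) = sqrt z ^ 3.
Proof.
intro hz. replace (3 / 2) with (1 + / 2) by lra.
rewrite Rpower_plus, Rpower_1, Rpower_sqrt by exact hz.
rewrite <- (sqrt_sqrt z) at 1 by lra. ring.
Qed.

Lemma Int_part_range (a B : R) (K : nat) : 0 <= a <= B -> B < INR K ->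
  (0 <= Int_part a < 0 + Z.of_nat K)%Z.
Proof.
intros [h0 h1] hB. destruct (base_Int_part a) as [b1 b2]. rewrite INR_IZR_INZ in hB.
assert (IZR (Int_part a) < IZR (Z.of_nat K)) by lra.
assert (IZR (-1) < IZR (Int_part a)) by (simpl; lra).
apply lt_IZR in H, H0. lia.
Qed.

Lemma dist_int_witness (z : R) : exists p : Z, Rabs (z - IZR p) = dist_int z.
Proof. destruct (dist_int_min z) as [[p e] _]. exists p. now symmetry. Qed.

Lemma dist_int_le (z : R) (p : Z) : dist_int z <= Rabs (z - IZR p).
Proof. apply dist_int_min. now exists p. Qed.

Lemma dist_int_le_half (z : R) : dist_int z <= 1 / 2.
Proof.
destruct (base_Int_part z) as [h1 h2].
pose proof (dist_int_le z (Int_part z)) as a. pose proof (dist_int_le z (Int_part z + 1)) as b.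
rewrite plus_IZR in b. rewrite Rabs_pos_eq in a by lra. rewrite Rabs_left1 in b by lra. lra.
Qed.

Section ClassUpperBound.

Context (w l r : R) (G : curve) (HG : in_class w l r G).
Context (hl : 1 <= l) (hlr : l <= r) (hw : 0 <= w <= 1).
Context (X Y X1 Y1 X2 Y2 : R -> R) (HS : smooth_plane_curve G X Y X1 Y1 X2 Y2).

Let v (t : R) := sqrt (X1 t ^ 2 + Y1 t ^ 2).
Let s (t : R) : R := RInt v 0 t.

Let dX := spc_X _ _ _ _ _ _ _ HS.
Let dY := spc_Y _ _ _ _ _ _ _ HS.
Let dX1 := spc_X1 _ _ _ _ _ _ _ HS.
Let dY1 := spc_Y1 _ _ _ _ _ _ _ HS.
Let agree := spc_agree _ _ _ _ _ _ _ HS.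

Lemma class_det_neq0 t : I01 t -> X1 t * Y2 t - X2 t * Y1 t <> 0.
Proof.
intro ht. destruct (agree t ht) as [_ [_ [-> [-> [-> ->]]]]]. now apply curve_convex.
Qed.

Lemma class_det_le t : I01 t -> Rabs (X1 t * Y2 t - X2 t * Y1 t) <= v t ^ 3 / r.
Proof.
intro ht. pose proof (class_det_neq0 t ht) as d0.
destruct HG as [_ [_ [[_ rm] _]]].
specialize (rm (curvature_radius G t) (ex_intro _ t (conj ht eq_refl))).
unfold curvature_radius in rm. unfold v.
destruct (agree t ht) as [_ [_ [e1 [e2 [e3 e4]]]]].
rewrite <- e1, <- e2, <- e3, <- e4 in rm.
assert (0 < X1 t ^ 2 + Y1 t ^ 2).
{ destruct (Req_dec (X1 t) 0); [destruct (Req_dec (Y1 t) 0)|]; nra. }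
rewrite Rpower_3_2 in rm by assumption.
assert (D : 0 < Rabs (X1 t * Y2 t - X2 t * Y1 t)) by now apply Rabs_pos_lt.
apply Rmult_le_reg_r with r; [lra|].
unfold Rdiv. rewrite Rmult_assoc, Rinv_l, Rmult_1_r by lra.
apply (Rmult_le_compat_r _ _ _ (Rlt_le _ _ D)) in rm.
unfold Rdiv in rm. rewrite Rmult_assoc, Rinv_l, Rmult_1_r in rm by lra. lra.
Qed.

Lemma class_length : s 1 = l.
Proof.
destruct HG as [_ [<- _]]. unfold s, curve_length. apply RInt_ext.
intros t ht. rewrite Rmin_left, Rmax_right in ht by lra.
destruct (agree t) as [_ [_ [e1 [e2 _]]]]; [unfold I01; lra|].
unfold v. now rewrite e1, e2.
Qed.

Lemma class_radius_gt0 : 0 < r.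
Proof. lra. Qed.

Lemma class_length_le_radius : s 1 <= r.
Proof. rewrite class_length. exact hlr. Qed.

Definition lattice_param (p : Z * Z) : R :=
  epsilon (inhabits 0) (fun t => I01 t /\ cx G t = IZR (fst p) /\ cy G t = IZR (snd p)).

Lemma lattice_param_spec p : lattice_points G p ->
  I01 (lattice_param p) /\ X (lattice_param p) = IZR (fst p) /\ Y (lattice_param p) = IZR (snd p).
Proof.
intro hp. pose proof (epsilon_spec (inhabits 0) _ hp) as [h1 [h2 h3]].
fold (lattice_param p) in *. destruct (agree _ h1) as [-> [-> _]]. auto.
Qed.

Lemma lattice_param_inj p q : lattice_points G p -> lattice_points G q ->
  lattice_param p = lattice_param q -> p = q.
Proof.
intros hp hq e. destruct (lattice_param_spec p hp) as [_ [xp yp]].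
destruct (lattice_param_spec q hq) as [_ [xq yq]]. rewrite e in xp, yp.
rewrite xp in xq. rewrite yp in yq. apply eq_IZR in xq, yq.
destruct p, q; simpl in *; congruence.
Qed.

(** Adjacent transpositions generate all permutations of three points, so a relation invariant under
    them need only be refuted for increasing parameters. *)
Lemma sort_three_points (Q : Z * Z -> Z * Z -> Z * Z -> Prop) :
  (forall a b c, Q a b c -> Q b a c) -> (forall a b c, Q a b c -> Q a c b) ->
  (forall a b c, lattice_points G a -> lattice_points G b -> lattice_points G c ->
    lattice_param a < lattice_param b < lattice_param c -> ~ Q a b c) ->
  forall a b c, lattice_points G a -> lattice_points G b -> lattice_points G c ->
    a <> b -> b <> c -> a <> c -> ~ Q a b c.
Proof.
intros s1 s2 H a b c ha hb hc ab bc ac q.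
assert (lattice_param a <> lattice_param b) by (intro; apply ab, lattice_param_inj; auto).
assert (lattice_param b <> lattice_param c) by (intro; apply bc, lattice_param_inj; auto).
assert (lattice_param a <> lattice_param c) by (intro; apply ac, lattice_param_inj; auto).
destruct (Rle_lt_dec (lattice_param a) (lattice_param b));
destruct (Rle_lt_dec (lattice_param b) (lattice_param c));
destruct (Rle_lt_dec (lattice_param a) (lattice_param c)); try lra.
- apply (H a b c); auto; lra.
- apply (H a c b); auto; lra.
- apply (H c a b); auto; lra.
- apply (H b a c); auto; lra.
- apply (H b c a); auto; lra.
- apply (H c b a); auto; lra.
Qed.

Lemma lattice_line_at_most_two (p q : Z) (a b c : Z * Z) :
  (p <> 0 \/ q <> 0)%Z ->
  lattice_points G a -> lattice_points G b -> lattice_points G c ->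
  a <> b -> b <> c -> a <> c ->
  (q * snd a - p * fst a = q * snd b - p * fst b)%Z ->
  (q * snd b - p * fst b = q * snd c - p * fst c)%Z -> False.
Proof.
intros pq ha hb hc ab bc ac e1 e2.
apply (sort_three_points (fun a b c => q * snd a - p * fst a = q * snd b - p * fst b /\
  q * snd b - p * fst b = q * snd c - p * fst c)%Z) with a b c; auto; try (intros; lia).
clear ab bc ac e1 e2 ha hb hc a b c. intros a b c ha hb hc lt [e1 e2].
destruct (lattice_param_spec a ha) as [ia [xa ya]].
destruct (lattice_param_spec b hb) as [ib [xb yb]].
destruct (lattice_param_spec c hc) as [ic [xc yc]].
apply (line_meets_at_most_twice X Y X1 Y1 X2 Y2 r dX dY dX1 dY1 class_det_neq0 class_det_le
  class_radius_gt0 class_length_le_radius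
  (IZR p) (IZR q) (lattice_param a) (lattice_param b) (lattice_param c)); auto.
- destruct pq as [h|h]; [left|right]; intro k; apply h, eq_IZR, k.
- rewrite xa, ya, xb, yb, <- !mult_IZR, <- !minus_IZR. now f_equal.
- rewrite xc, yc, xb, yb, <- !mult_IZR, <- !minus_IZR. now f_equal.
Qed.

Lemma three_lattice_points_arc (a b c : Z * Z) (h : R) :
  lattice_points G a -> lattice_points G b -> lattice_points G c ->
  a <> b -> b <> c -> a <> c ->
  (forall x y, In x [a; b; c] -> In y [a; b; c] ->
     s (lattice_param x) - s (lattice_param y) <= h) ->
  r <= 2 * h ^ 3.
Proof.
intros ha hb hc ab bc ac H. apply Rnot_lt_le. intro lt.
apply (sort_three_points (fun a b c => (a <> b /\ b <> c /\ a <> c) /\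
  forall x y, In x [a; b; c] -> In y [a; b; c] ->
     s (lattice_param x) - s (lattice_param y) <= h)) with a b c; auto.
- clear. intros a b c [n Q]. split; [intuition congruence|].
  intros x y hx hy. apply Q; simpl in *; tauto.
- clear. intros a b c [n Q]. split; [intuition congruence|].
  intros x y hx hy. apply Q; simpl in *; tauto.
- clear H ab bc ac ha hb hc a b c. intros a b c ha hb hc lt3 [[ab [bc ac]] H].
  specialize (H c a ltac:(simpl; tauto) ltac:(simpl; tauto)).
  assert (D : ((fst b - fst a) * (snd c - snd a) - (snd b - snd a) * (fst c - fst a) <> 0)%Z).
  { intro D.
    apply (lattice_line_at_most_two (snd c - snd a) (fst c - fst a) a b c); auto; try lia.
    destruct (Z.eq_dec (fst a) (fst c)); [|lia].
    destruct (Z.eq_dec (snd a) (snd c)); [|lia].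
    exfalso; apply ac. destruct a, c; simpl in *; congruence. }
  destruct (lattice_param_spec a ha) as [ia [xa ya]].
  destruct (lattice_param_spec b hb) as [ib [xb yb]].
  destruct (lattice_param_spec c hc) as [ic [xc yc]].
  pose proof (triangle_area_le X Y X1 Y1 X2 Y2 r dX dY dX1 dY1 class_det_neq0 class_det_le class_radius_gt0
    (lattice_param a) (lattice_param b) (lattice_param c) ia ic ltac:(lra)) as A.
  cbv beta zeta in A. change (fun t => sqrt (X1 t ^ 2 + Y1 t ^ 2)) with v in A.
  change (RInt v 0 (lattice_param c)) with (s (lattice_param c)) in A.
  change (RInt v 0 (lattice_param a)) with (s (lattice_param a)) in A.
  rewrite xa, ya, xb, yb, xc, yc, <- !minus_IZR, <- !mult_IZR, <- minus_IZR in A.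
  rewrite <- abs_IZR in A.
  assert (B : IZR 1 <= IZR (Z.abs ((fst b - fst a) * (snd c - snd a) - (snd b - snd a) * (fst c - fst a))))
    by (apply IZR_le; lia).
  pose proof (arclength_increment_ge0 X1 Y1 X2 Y2 dX1 dY1 (lattice_param a) (lattice_param c) ltac:(lra)) as P.
  change (0 <= s (lattice_param c) - s (lattice_param a)) in P.
  set (S := s (lattice_param c) - s (lattice_param a)) in *.
  assert (S ^ 3 <= h ^ 3) by (apply pow_incr; lra).
  assert (C : 1 <= 2 * S ^ 3 / r) by lra.
  apply (Rmult_le_compat_r r) in C; [|lra].
  unfold Rdiv in C. rewrite Rmult_assoc, Rinv_l in C by lra. lra.
Qed.

Lemma s_range t : I01 t -> 0 <= s t <= l.
Proof.
intro ht. rewrite <- class_length. destruct ht.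
pose proof (arclength_increment_ge0 X1 Y1 X2 Y2 dX1 dY1 0 t ltac:(lra)) as P.
pose proof (arclength_increment_ge0 X1 Y1 X2 Y2 dX1 dY1 t 1 ltac:(lra)) as Q.
change (0 <= s t - s 0) in P. change (0 <= s 1 - s t) in Q.
assert (s 0 = 0) by (unfold s; rewrite RInt_point; reflexivity). lra.
Qed.

(** The curve is cut into arcs of length [h], indexed by the integer part of arclength over [h]; an
    arc holding three lattice points would give [r <= 2 * h ^ 3]. *)
Lemma lattice_points_le_curvature (h : R) (K : nat) (L : list (Z * Z)) :
  0 < h -> 2 * h ^ 3 < r -> l / h < INR K ->
  NoDup L -> (forall p, In p L -> lattice_points G p) -> (length L <= 2 * K)%nat.
Proof.
intros h0 hr hK nd hL.
apply (NoDup_length_le_twice_keys (fun p => Int_part (s (lattice_param p) / h)) 0 K L nd).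
- intros p hp. destruct (lattice_param_spec p (hL p hp)) as [ip _].
  pose proof (s_range _ ip). assert (0 < / h) by now apply Rinv_0_lt_compat.
  apply (Int_part_range _ (l / h)); [|exact hK]. unfold Rdiv. split.
  + apply Rmult_le_pos; lra.
  + apply Rmult_le_compat_r; lra.
- intros x y z hx hy hz xy yz xz e1 e2.
  assert (r <= 2 * h ^ 3); [|lra].
  apply (three_lattice_points_arc x y z); auto.
  assert (K1 : forall u, In u [x; y; z] ->
    Int_part (s (lattice_param u) / h) = Int_part (s (lattice_param x) / h)).
  { intros u hu. simpl in hu. intuition (subst; congruence). }
  intros a b ia ib.
  destruct (base_Int_part (s (lattice_param a) / h)) as [a1 a2].
  destruct (base_Int_part (s (lattice_param b) / h)) as [b1 b2].
  rewrite (K1 a ia) in *. rewrite (K1 b ib) in *.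
  assert (D : s (lattice_param a) / h - s (lattice_param b) / h <= 1) by lra.
  apply (Rmult_le_compat_r h) in D; [|lra]. field_simplify in D; lra.
Qed.

Lemma initial_velocity : 0 < X1 0 /\ Y1 0 = w * X1 0.
Proof.
assert (i0 : I01 0) by (unfold I01; lra).
pose proof (class_det_neq0 0 i0) as d0.
destruct HG as [[n1 n2] [_ [_ e]]]. unfold initial_slope in e.
destruct (agree 0 i0) as [_ [_ [e1 [e2 _]]]]. rewrite <- e1, <- e2 in *.
assert (0 < X1 0).
{ destruct (Rle_lt_dec (X1 0) 0) as [h|h]; [|exact h]. exfalso; apply d0.
  replace (X1 0) with 0 by lra. replace (Y1 0) with 0 by lra. ring. }
split; [assumption|]. rewrite <- e. field; lra.
Qed.

Lemma lattice_points_le_slope (q : nat) (K : nat) (L : list (Z * Z)) :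
  (1 <= q)%nat -> 3 * (l * (INR q * (l * / r) + dist_int (INR q * w))) + 1 < INR K ->
  NoDup L -> (forall p, In p L -> lattice_points G p) -> (length L <= 2 * K)%nat.
Proof.
intros q1 hK nd hL.
assert (Q1 : 1 <= INR q) by (change 1 with (INR 1); now apply le_INR).
destruct (dist_int_witness (INR q * w)) as [p hp].
pose proof (dist_int_le_half (INR q * w)) as half.
set (d := dist_int (INR q * w)) in *.
assert (d0 : 0 <= d) by apply dist_int_ge0.
(* Since [|p| <= q * w + 1 / 2 <= 2 * q], the vector [(p, q)] has norm at most [3 * q]: the source
   of the factor 3 in [k]. *)
assert (pq : Rabs (IZR p) <= 2 * INR q).
{ apply Rabs_le. rewrite <- hp in half. apply Rabs_le_between in half. nra. }
assert (l0 : 0 < l / r) by (apply Rmult_lt_0_compat; [|apply Rinv_0_lt_compat]; lra).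
assert (i0 : I01 0) by (unfold I01; lra).
destruct initial_velocity as [x0 y0].
pose proof (speed_sqr X1 Y1 0) as vs. change (v 0 ^ 2 = X1 0 ^ 2 + Y1 0 ^ 2) in vs.
pose proof (speed_gt0 X1 Y1 X2 Y2 class_det_neq0 0 i0) as v0. change (0 < v 0) in v0.
set (k := 3 * (INR q * (l * / r) + d)).
assert (V : forall u t, I01 u -> I01 t -> u <= t ->
   Rabs ((INR q * Y t - IZR p * X t) - (INR q * Y u - IZR p * X u)) <= k * (s t - s u)).
{ intros u t hu ht ut.
  pose proof (linear_form_variation X Y X1 Y1 X2 Y2 r dX dY dX1 dY1 class_det_neq0 class_det_le class_radius_gt0
    (IZR p) (INR q) (3 * INR q) u t hu ht ut ltac:(lra)) as H.
  cbv beta zeta in H. change (fun t => sqrt (X1 t ^ 2 + Y1 t ^ 2)) with v in H.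
  change (RInt v 0 1) with (s 1) in H. change (RInt v 0 t) with (s t) in H.
  change (RInt v 0 u) with (s u) in H. change (sqrt (X1 0 ^ 2 + Y1 0 ^ 2)) with (v 0) in H.
  rewrite class_length in H.
  eapply Rle_trans; [apply H|].
  - apply Rabs_le_between in pq. nra.
  - apply Rmult_le_compat_r.
    + pose proof (arclength_increment_ge0 X1 Y1 X2 Y2 dX1 dY1 u t ut) as P. exact P.
    (* The initial unit tangent is [(1, w)] times [X1 0 / v 0 <= 1], so the initial value of the
       form is at most [d]. *)
    + assert (E : Rabs (INR q * (Y1 0 / v 0) - IZR p * (X1 0 / v 0)) <= d).
      { rewrite y0. replace (INR q * (w * X1 0 / v 0) - IZR p * (X1 0 / v 0))
          with ((INR q * w - IZR p) * (X1 0 / v 0)) by (field; lra).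
        rewrite Rabs_mult, hp.
        assert (X1 0 / v 0 <= 1).
        { apply Rmult_le_reg_r with (v 0); [lra|]. unfold Rdiv.
          rewrite Rmult_assoc, Rinv_l by lra. nra. }
        assert (0 < X1 0 / v 0) by (apply Rmult_lt_0_compat; [lra | now apply Rinv_0_lt_compat]).
        rewrite (Rabs_pos_eq (X1 0 / v 0)) by lra. nra. }
      unfold k. unfold Rdiv in *. lra. }
set (F := fun a : Z * Z => (Z.of_nat q * snd a - p * fst a)%Z).
assert (FE : forall a, In a L -> IZR (F a) = INR q * Y (lattice_param a) - IZR p * X (lattice_param a)).
{ intros a ha. destruct (lattice_param_spec a (hL a ha)) as [_ [-> ->]].
  unfold F. rewrite minus_IZR, !mult_IZR, <- INR_IZR_INZ. reflexivity. }
assert (k0 : 0 <= k) by (unfold k, Rdiv in *; nra).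
assert (VF : forall a b, In a L -> In b L -> Rabs (IZR (F a) - IZR (F b)) <= k * l).
{ intros a b ha hb. rewrite (FE a ha), (FE b hb).
  destruct (lattice_param_spec a (hL a ha)) as [ia _].
  destruct (lattice_param_spec b (hL b hb)) as [ib _].
  pose proof (s_range _ ia). pose proof (s_range _ ib).
  destruct (Rle_lt_dec (lattice_param b) (lattice_param a)) as [c|c].
  - eapply Rle_trans; [apply V; auto|]. apply Rmult_le_compat_l; lra.
  - rewrite Rabs_minus_sym. eapply Rle_trans; [apply V; auto; lra|]. apply Rmult_le_compat_l; lra. }
destruct L as [|a L']; [simpl; lia|].
assert (M : exists m, In m (a :: L') /\ forall b, In b (a :: L') -> (F m <= F b)%Z).
{ clear. generalize a. induction L' as [|c L IH]; intro a0.
  - exists a0. split; [simpl; tauto|]. intros b [<-|[]]; lia.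
  - destruct (IH c) as [m [im hm]]. destruct (Z_le_gt_dec (F a0) (F m)).
    + exists a0. split; [simpl; tauto|]. intros b [<-|hb]; [lia|]. specialize (hm b hb). lia.
    + exists m. split; [right; exact im|]. intros b [<-|hb]; [lia|]. now apply hm. }
destruct M as [m [im hm]].
apply (NoDup_length_le_twice_keys F (F m) K _ nd).
- intros b hb. specialize (hm b hb). split; [exact hm|].
  pose proof (VF b m hb im) as D. apply Rabs_le_between in D.
  assert (IZR (F b) < IZR (F m + Z.of_nat K)); [|now apply lt_IZR].
  rewrite plus_IZR, <- INR_IZR_INZ. unfold k in D. lra.
- intros x y z hx hy hz xy yz xz e1 e2. unfold F in e1, e2.
  apply (lattice_line_at_most_two p (Z.of_nat q) x y z); auto. right; lia.
Qed.

End ClassUpperBound.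

(** * Convex functions through lattice points *)

Ltac ring_R := match goal with |- @eq _ ?a ?b => change (@eq R a b); ring end.

Definition pos_part (t : R) : R := Rmax 0 t.

Lemma pos_part_nonneg t : 0 <= t -> pos_part t = t.
Proof. apply Rmax_right. Qed.

Lemma pos_part_nonpos t : t <= 0 -> pos_part t = 0.
Proof. apply Rmax_left. Qed.

Lemma continuous_pos_part t : continuous pos_part t.
Proof.
apply continuity_pt_filterlim. intros e he. exists e. split; [exact he|].
intros z [_ hz]. simpl in *. unfold R_dist, pos_part, Rmax in *.
repeat destruct Rle_dec; revert hz; unfold Rabs; repeat destruct Rcase_abs; lra.
Qed.

Lemma is_derive_pos_part_sqr t : is_derive (fun z => pos_part z ^ 2) t (2 * pos_part t).
Proof.
destruct (Rtotal_order t 0) as [h|[->|h]].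
- rewrite pos_part_nonpos, Rmult_0_r by lra.
  apply (is_derive_ext_loc (fun _ => 0)); [|apply (is_derive_const (V := R_NormedModule))].
  assert (L : locally t (fun y => y < 0)) by (apply (open_lt 0); lra).
  revert L. apply filter_imp. intros y hy. rewrite pos_part_nonpos, pow_i by (lra || lia). reflexivity.
- apply is_derive_Reals. intros e he. exists (mkposreal e he). intros h h0 hh. simpl in hh.
  rewrite Rplus_0_l, (pos_part_nonpos 0) by lra. unfold pos_part, Rmax.
  destruct Rle_dec.
  + replace ((h ^ 2 - 0 ^ 2) / h - 2 * 0) with h by (field; exact h0). exact hh.
  + replace ((0 ^ 2 - 0 ^ 2) / h - 2 * 0) with 0 by (field; exact h0). rewrite Rabs_R0. exact he.
- rewrite pos_part_nonneg by lra.
  apply (is_derive_ext_loc (fun z => z ^ 2)); [|auto_derive; [exact I | ring]].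
  assert (L : locally t (fun y => 0 < y)) by (apply (open_gt 0); lra).
  revert L. apply filter_imp. intros y hy. rewrite pos_part_nonneg by lra. reflexivity.
Qed.

Lemma is_derive_pos_part_cube t : is_derive (fun z => pos_part z ^ 3) t (3 * pos_part t ^ 2).
Proof.
assert (M : forall z, z * pos_part z = pos_part z ^ 2).
{ intro z. unfold pos_part, Rmax; destruct Rle_dec; ring. }
apply (is_derive_ext (fun z => z * pos_part z ^ 2)).
{ intro z. rewrite <- (M z). replace (z * (z * pos_part z)) with (z * pos_part z ^ 2) by (rewrite M; ring).
  replace (z * pos_part z ^ 2) with ((z * pos_part z) * pos_part z) by ring.
  rewrite M; ring_R. }
evar_last.
- apply (is_derive_mult (fun z : R => z) (fun z => pos_part z ^ 2) t 1 (2 * pos_part t)).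
  + apply (is_derive_id (K := R_AbsRing)).
  + apply is_derive_pos_part_sqr.
  + intros; apply Rmult_comm.
- change (1 * pos_part t ^ 2 + t * (2 * pos_part t) = 3 * pos_part t ^ 2). rewrite <- M. ring.
Qed.

(** The tent on [0,2] with peak 1 at 1, written as a second difference of truncated powers so that
    its first two primitives, null for [s <= 0], are explicit. Their values from 2 on give the slope
    and height that it adds. *)
Definition hat (s : R) := pos_part s - 2 * pos_part (s - 1) + pos_part (s - 2).
Definition hat_prim (s : R) := (pos_part s ^ 2 - 2 * pos_part (s - 1) ^ 2 + pos_part (s - 2) ^ 2) / 2.
Definition hat_prim2 (s : R) := (pos_part s ^ 3 - 2 * pos_part (s - 1) ^ 3 + pos_part (s - 2) ^ 3) / 6.

Lemma is_derive_comp_affine (f : R -> R) (c a t d : R) :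
  is_derive f (c * t + a) d -> is_derive (fun z => f (c * z + a)) t (c * d).
Proof.
intro H. apply (is_derive_comp f (fun z => c * z + a) t d c H).
auto_derive; [exact I | ring].
Qed.

Lemma is_derive_shift (f : R -> R) (a t d : R) :
  is_derive f (t - a) d -> is_derive (fun z => f (z - a)) t d.
Proof.
intro H. rewrite <- (Rmult_1_l d). apply (is_derive_comp f (fun z => z - a) t d 1 H).
auto_derive; [exact I | ring].
Qed.

Lemma is_derive_hat_prim s : is_derive hat_prim s (hat s).
Proof.
unfold hat_prim. apply (is_derive_ext (fun s =>
  / 2 * (pos_part s ^ 2 - 2 * pos_part (s - 1) ^ 2 + pos_part (s - 2) ^ 2))).
{ intro; unfold Rdiv; apply Rmult_comm. }
replace (hat s) with (/ 2 * (2 * pos_part s - 2 * (2 * pos_part (s - 1)) + 2 * pos_part (s - 2)))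
  by (unfold hat; field).
apply is_derive_Rscal, is_derive_Rplus; [apply is_derive_Rminus; [|apply is_derive_Rscal]|].
- apply is_derive_pos_part_sqr.
- apply (is_derive_shift (fun z => pos_part z ^ 2)), is_derive_pos_part_sqr.
- apply (is_derive_shift (fun z => pos_part z ^ 2)), is_derive_pos_part_sqr.
Qed.

Lemma is_derive_hat_prim2 s : is_derive hat_prim2 s (hat_prim s).
Proof.
unfold hat_prim2. apply (is_derive_ext (fun s =>
  / 6 * (pos_part s ^ 3 - 2 * pos_part (s - 1) ^ 3 + pos_part (s - 2) ^ 3))).
{ intro; unfold Rdiv; apply Rmult_comm. }
replace (hat_prim s) with (/ 6 * (3 * pos_part s ^ 2 - 2 * (3 * pos_part (s - 1) ^ 2) + 3 * pos_part (s - 2) ^ 2))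
  by (unfold hat_prim; field).
apply is_derive_Rscal, is_derive_Rplus; [apply is_derive_Rminus; [|apply is_derive_Rscal]|].
- apply is_derive_pos_part_cube.
- apply (is_derive_shift (fun z => pos_part z ^ 3)), is_derive_pos_part_cube.
- apply (is_derive_shift (fun z => pos_part z ^ 3)), is_derive_pos_part_cube.
Qed.

Lemma continuous_hat s : continuous hat s.
Proof.
apply continuity_pt_filterlim. unfold hat.
assert (P : forall a, continuity_pt (fun z => pos_part (z - a)) s).
{ intro a. apply (continuity_pt_comp (fun z => z - a) pos_part).
  - apply continuity_pt_filterlim, continuous_Rminus; [apply continuous_id | apply continuous_const].
  - apply continuity_pt_filterlim, continuous_pos_part. }
apply (continuity_pt_plus (fun z => pos_part z - 2 * pos_part (z - 1)) (fun z => pos_part (z - 2))); [|apply P].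
apply (continuity_pt_minus pos_part (fun z => 2 * pos_part (z - 1))).
- apply continuity_pt_filterlim, continuous_pos_part.
- apply (continuity_pt_scal (fun z => pos_part (z - 1)) 2). apply P.
Qed.

(** Hence a combination of the tent and its translate with nonnegative heights never exceeds the
    larger height. *)
Lemma hat_weights s : 0 <= hat s /\ 0 <= hat (s - 1) /\ hat s + hat (s - 1) <= 1.
Proof. unfold hat, pos_part, Rmax; repeat destruct Rle_dec; lra. Qed.

Lemma hat_nonpos s : s <= 0 -> hat s = 0 /\ hat_prim s = 0 /\ hat_prim2 s = 0.
Proof.
intro h. unfold hat, hat_prim, hat_prim2. rewrite !pos_part_nonpos by lra.
repeat split; field.
Qed.

Lemma hat_ge2 s : 2 <= s -> hat s = 0 /\ hat_prim s = 1 /\ hat_prim2 s = s - 1.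
Proof.
intro h. unfold hat, hat_prim, hat_prim2. rewrite !pos_part_nonneg by lra.
repeat split; field.
Qed.

(* A convex function [f] (with [f'' = eps] from [X] on) through the points
   [(a + d, f (a + d) = b)] for [(a, b)] in [pts], the last of them at abscissa [X]
   with slope [sigma]. *)
Record profile (w k eps X sigma d : R) (pts : list (Z * Z)) (f f1 f2 : R -> R) : Prop := {
  pr_d1 : forall t, is_derive f t (f1 t);
  pr_d2 : forall t, is_derive f1 t (f2 t);
  pr_c2 : forall t, continuous f2 t;
  pr_slope0 : f1 0 = w;
  pr_curv0 : f2 0 = k;
  pr_curv : forall t, 0 <= t -> 0 < f2 t <= k;
  pr_X : 0 <= X;
  pr_tail : forall t, X <= t ->
    f t = f X + sigma * (t - X) + eps * (t - X) ^ 2 / 2 /\ f1 t = sigma + eps * (t - X) /\ f2 t = eps;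
  pr_pts : forall p, In p pts -> 0 <= IZR (fst p) + d <= X /\ f (IZR (fst p) + d) = IZR (snd p);
  pr_nodup : NoDup pts;
  pr_last : exists p, In p pts /\ IZR (fst p) + d = X }.

Lemma profile_start (w k eps sigma : R) :
  0 < eps <= k -> w < sigma ->
  exists X d f f1 f2, profile w k eps X sigma d [(0, 0)%Z] f f1 f2 /\ X <= 2 * (sigma - w) / k.
Proof.
intros [e0 ek] ws.
set (d := 2 * (sigma - w) / (k + eps)).
assert (d0 : 0 < d) by (apply Rmult_lt_0_compat; [lra | apply Rinv_0_lt_compat; lra]).
assert (hd : d * (k + eps) = 2 * (sigma - w)) by (unfold d; field; lra).
set (c := k - eps).
set (g := fun t => w * t + eps * t ^ 2 / 2 + c * d / 2 * t + c * d ^ 2 / 6 * pos_part (- / d * t + 1) ^ 3).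
set (g1 := fun t => w + eps * t + c * d / 2 - c * d / 2 * pos_part (- / d * t + 1) ^ 2).
set (g2 := fun t => eps + c * pos_part (- / d * t + 1)).
assert (dd : / d * d = 1) by (field; lra).
exists d, d, (fun t => g t - g d), g1, g2. split; [split|].
- intro t. evar_last.
  + apply is_derive_Rminus; [|apply (is_derive_const (V := R_NormedModule))].
    unfold g. apply is_derive_Rplus.
    * instantiate (1 := w + eps * t + c * d / 2). auto_derive; [exact I | field].
    * apply is_derive_Rscal. apply (is_derive_comp_affine (fun z => pos_part z ^ 3)).
      apply is_derive_pos_part_cube.
  + unfold g1, zero; simpl. field; lra.
- intro t. unfold g1. evar_last.
  + apply is_derive_Rminus.
    * instantiate (1 := eps). auto_derive; [exact I | field].
    * apply is_derive_Rscal. apply (is_derive_comp_affine (fun z => pos_part z ^ 2)).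
      apply is_derive_pos_part_sqr.
  + unfold g2. field; lra.
- intro t. apply continuity_pt_filterlim. unfold g2.
  apply (continuity_pt_plus (fun _ => eps) (fun t => c * pos_part (- / d * t + 1))).
  + apply continuity_pt_const. intros ? ?; reflexivity.
  + apply (continuity_pt_scal (fun t => pos_part (- / d * t + 1)) c).
    apply (continuity_pt_comp (fun t => - / d * t + 1) pos_part).
    * apply continuity_pt_filterlim, (ex_derive_continuous (fun t => - / d * t + 1)). auto_derive. exact I.
    * apply continuity_pt_filterlim, continuous_pos_part.
- unfold g1. cbv beta. rewrite pos_part_nonneg by lra. field; lra.
- unfold g2. cbv beta. rewrite pos_part_nonneg by lra. unfold c. ring.
- intros t ht. unfold g2.
  assert (0 <= / d * t) by (apply Rmult_le_pos; [left; now apply Rinv_0_lt_compat | exact ht]).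
  assert (0 <= pos_part (- / d * t + 1) <= 1) by (unfold pos_part, Rmax; destruct Rle_dec; lra).
  unfold c; nra.
- lra.
- intros t ht.
  assert (1 <= / d * t).
  { rewrite <- dd. apply Rmult_le_compat_l; [left; now apply Rinv_0_lt_compat | exact ht]. }
  assert (E : w + c * d / 2 + eps * d = sigma) by (unfold c; lra).
  unfold g, g1, g2. cbv beta. rewrite !pos_part_nonpos by lra. rewrite <- E. repeat split; field; lra.
- intros p [<-|[]]. simpl. rewrite Rplus_0_l. split; [lra|]. ring.
- constructor; [intros [] | constructor].
- exists (0, 0)%Z. simpl. split; [now left | ring].
- unfold d, Rdiv. apply Rmult_le_compat_l; [lra|]. apply Rinv_le_contravar; lra.
Qed.

(* The two hats have heights [h1], [h2] chosen so that the chord of the new cell has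
   slope [tau] and the slope at its end is [sigma']. *)
Lemma profile_append (w k eps X sigma d : R) (pts : list (Z * Z)) (f f1 f2 : R -> R)
    (sigma' tau : R) (dx dy : Z) :
  profile w k eps X sigma d pts f f1 f2 ->
  0 < eps -> sigma < sigma' -> (0 < dx)%Z ->
  IZR dy = tau * IZR dx ->
  4 / 10 * (sigma' - sigma) <= tau - sigma <= 6 / 10 * (sigma' - sigma) ->
  10 * eps * IZR dx <= sigma' - sigma -> 3 * (sigma' - sigma) <= k * IZR dx ->
  exists p g g1 g2, profile w k eps (X + IZR dx) sigma' d (p :: pts) g g1 g2.
Proof.
intros P e0 ss dx0 hdy hmid heps hk.
apply IZR_lt in dx0. set (D := IZR dx) in *.
set (G := sigma' - sigma) in *. set (al := tau - sigma) in *.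
(* Two tents of half-width [a], starting at [X] and at [X + a], exactly fill the cell [[X, X + D]];
   [u] rescales them to [hat]. *)
set (a := D / 3). assert (a0 : 0 < a) by (unfold a; lra).
(* Solution of [a * (h1 + h2) + eps * D = G] (slope gain) and [a ^ 2 * (2 * h1 + h2) + eps * D ^ 2 /
   2 = al * D] (height above the line of slope [sigma]). The window from 4/10 to 6/10 and the
   smallness of [eps * D] make both heights nonnegative. *)
set (h1 := 3 * (2 * al - (G - al) - eps * D / 2) / D).
set (h2 := 3 * (2 * (G - al) - al - eps * D / 2) / D).
assert (h1D : h1 * D = 3 * (2 * al - (G - al) - eps * D / 2)) by (unfold h1; field; lra).
assert (h2D : h2 * D = 3 * (2 * (G - al) - al - eps * D / 2)) by (unfold h2; field; lra).
assert (G0 : 0 < G) by (unfold G; lra).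
assert (h10 : 0 <= h1) by (apply Rmult_le_reg_r with D; nra).
assert (h20 : 0 <= h2) by (apply Rmult_le_reg_r with D; nra).
assert (h1k : eps + h1 <= k) by (apply Rmult_le_reg_r with D; nra).
assert (h2k : eps + h2 <= k) by (apply Rmult_le_reg_r with D; nra).
set (u := fun t => / a * t + (- X / a)).
assert (uE : forall t, u t = (t - X) / a) by (intro t; unfold u; field; lra).
assert (u0 : forall t, t <= X -> u t <= 0).
{ intros t ht. rewrite uE. unfold Rdiv. pose proof (Rinv_0_lt_compat a a0). nra. }
assert (u3 : forall t, X + D <= t -> 3 <= u t).
{ intros t ht. rewrite uE. apply Rmult_le_reg_r with a; [lra|].
  unfold Rdiv. rewrite Rmult_assoc, Rinv_l by lra. unfold a; lra. }
set (g := fun t => f t + a ^ 2 * (h1 * hat_prim2 (u t) + h2 * hat_prim2 (u t - 1))).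
set (g1 := fun t => f1 t + a * (h1 * hat_prim (u t) + h2 * hat_prim (u t - 1))).
set (g2 := fun t => f2 t + (h1 * hat (u t) + h2 * hat (u t - 1))).
destruct (pr_last _ _ _ _ _ _ _ _ _ _ P) as [[px py] [ip ep]]. simpl in ep.
destruct (pr_pts _ _ _ _ _ _ _ _ _ _ P _ ip) as [_ fp]. simpl in fp. rewrite ep in fp.
assert (du : forall (F F' : R -> R) t, (forall s, is_derive F s (F' s)) ->
  is_derive (fun t => a * F (u t)) t (F' (u t)) /\ is_derive (fun t => a * F (u t - 1)) t (F' (u t - 1))).
{ intros F F' t H. split.
  - replace (F' (u t)) with (a * (/ a * F' (u t))) by (field; lra).
    apply is_derive_Rscal. apply (is_derive_comp_affine F). apply H.
  - replace (F' (u t - 1)) with (a * (/ a * F' (u t - 1))) by (field; lra).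
    apply is_derive_Rscal. apply (is_derive_comp_affine (fun z => F (z - 1))). apply is_derive_shift, H. }
assert (g_tail : forall t, X + D <= t ->
  g t = IZR py + tau * D + sigma' * (t - (X + D)) + eps * (t - (X + D)) ^ 2 / 2 /\
  g1 t = sigma' + eps * (t - (X + D)) /\ g2 t = eps).
{ intros t ht. specialize (u3 t ht).
  destruct (pr_tail _ _ _ _ _ _ _ _ _ _ P t ltac:(lra)) as [E [E1 E2]].
  destruct (hat_ge2 (u t)) as [q2 [q1 q0]]; [lra|].
  destruct (hat_ge2 (u t - 1)) as [z2 [z1 z0]]; [lra|].
  unfold g, g1, g2. rewrite E, E1, E2, q2, q1, q0, z2, z1, z0, fp, uE.
  replace sigma' with (sigma + G) by (unfold G; ring).
  replace tau with (sigma + al) by (unfold al; ring).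
  unfold a, h1, h2. repeat split; field; lra. }
exists (px + dx, py + dy)%Z, g, g1, g2. split.
- intro t. unfold g, g1. apply is_derive_Rplus; [apply (pr_d1 _ _ _ _ _ _ _ _ _ _ P)|].
  apply (is_derive_ext (fun t => a * (h1 * (a * hat_prim2 (u t)) + h2 * (a * hat_prim2 (u t - 1))))).
  { intro; ring_R. }
  apply is_derive_Rscal, is_derive_Rplus; apply is_derive_Rscal; apply (du hat_prim2 hat_prim), is_derive_hat_prim2.
- intro t. unfold g1, g2. apply is_derive_Rplus; [apply (pr_d2 _ _ _ _ _ _ _ _ _ _ P)|].
  apply (is_derive_ext (fun t => h1 * (a * hat_prim (u t)) + h2 * (a * hat_prim (u t - 1)))).
  { intro; ring_R. }
  apply is_derive_Rplus; apply is_derive_Rscal; apply (du hat_prim hat), is_derive_hat_prim.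
- intro t. apply continuity_pt_filterlim. unfold g2.
  assert (H : forall b, continuity_pt (fun t => hat (u t - b)) t).
  { intro b. apply (continuity_pt_comp (fun t => u t - b) hat).
    - apply continuity_pt_filterlim, (ex_derive_continuous (fun t => u t - b)).
      unfold u. auto_derive. exact I.
    - apply continuity_pt_filterlim, continuous_hat. }
  apply (continuity_pt_plus f2 (fun t => h1 * hat (u t) + h2 * hat (u t - 1))).
  + apply continuity_pt_filterlim, (pr_c2 _ _ _ _ _ _ _ _ _ _ P).
  + apply (continuity_pt_plus (fun t => h1 * hat (u t)) (fun t => h2 * hat (u t - 1))).
    * apply (continuity_pt_scal (fun t => hat (u t)) h1).
      apply (continuity_pt_ext (fun t => hat (u t - 0))); [intro; now rewrite Rminus_0_r | apply H].
    * apply (continuity_pt_scal (fun t => hat (u t - 1)) h2). apply H.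
- pose proof (u0 0 (pr_X _ _ _ _ _ _ _ _ _ _ P)). unfold g1.
  destruct (hat_nonpos (u 0)) as [_ [-> _]]; [lra|].
  destruct (hat_nonpos (u 0 - 1)) as [_ [-> _]]; [lra|].
  rewrite (pr_slope0 _ _ _ _ _ _ _ _ _ _ P). ring.
- pose proof (u0 0 (pr_X _ _ _ _ _ _ _ _ _ _ P)). unfold g2.
  destruct (hat_nonpos (u 0)) as [-> _]; [lra|].
  destruct (hat_nonpos (u 0 - 1)) as [-> _]; [lra|].
  rewrite (pr_curv0 _ _ _ _ _ _ _ _ _ _ P). ring.
- intros t ht. pose proof (pr_curv _ _ _ _ _ _ _ _ _ _ P t ht) as C. unfold g2.
  destruct (Rle_lt_dec t X) as [c|c].
  + pose proof (u0 t c).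
    destruct (hat_nonpos (u t)) as [-> _]; [lra|].
    destruct (hat_nonpos (u t - 1)) as [-> _]; lra.
  + destruct (pr_tail _ _ _ _ _ _ _ _ _ _ P t ltac:(lra)) as [_ [_ ->]].
    destruct (hat_weights (u t)) as [w1 [w2 w3]]. split; nra.
- pose proof (pr_X _ _ _ _ _ _ _ _ _ _ P). lra.
- intros t ht. destruct (g_tail t ht) as [-> [-> ->]].
  destruct (g_tail (X + D) ltac:(lra)) as [-> _]. repeat split; field.
- intros p [<-|hp].
  + simpl. rewrite !plus_IZR. fold D. replace (IZR px + D + d) with (X + D) by lra.
    pose proof (pr_X _ _ _ _ _ _ _ _ _ _ P). split; [lra|].
    destruct (g_tail (X + D) ltac:(lra)) as [-> _]. rewrite hdy. field.
  + destruct (pr_pts _ _ _ _ _ _ _ _ _ _ P p hp) as [b e]. split; [lra|].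
    unfold g. pose proof (u0 _ (proj2 b)).
    destruct (hat_nonpos (u (IZR (fst p) + d))) as [_ [_ ->]]; [lra|].
    destruct (hat_nonpos (u (IZR (fst p) + d) - 1)) as [_ [_ ->]]; [lra|].
    rewrite e. ring.
- constructor; [|apply (pr_nodup _ _ _ _ _ _ _ _ _ _ P)].
  intro hp. destruct (pr_pts _ _ _ _ _ _ _ _ _ _ P _ hp) as [b _]. simpl in b.
  rewrite plus_IZR in b. fold D in b. lra.
- exists (px + dx, py + dy)%Z. split; [now left|]. simpl. rewrite plus_IZR. fold D. lra.
Qed.

(** * From convex functions to curves of the class *)

Lemma D_in_I01_of_is_derive (f f' : R -> R) (t : R) : is_derive f t (f' t) -> D_in f f' I01 t.
Proof.
intro H. apply is_derive_Reals, derivable_pt_lim_D_in in H.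
intros e he. destruct (H e he) as [d [hd Hd]]. exists d. split; [exact hd|].
intros z [[_ nz] hz]. apply Hd. split; [split; [exact I | exact nz] | exact hz].
Qed.

Lemma continue_in_I01_of_continuous (f : R -> R) (t : R) : continuous f t -> continue_in f I01 t.
Proof.
intro H. apply continuity_pt_filterlim in H.
intros e he. destruct (H e he) as [d [hd Hd]]. exists d. split; [exact hd|].
intros z [[_ nz] hz]. apply Hd. split; [split; [exact I | exact nz] | exact hz].
Qed.

(** The shift by [- d] makes the marked abscissas [a + d] integral and changes neither slopes nor
    length nor curvature. [L] is left free for the adjustment of the length. *)
Lemma graph_curve (f f1 f2 : R -> R) (L d : R) :
  (forall t, is_derive f t (f1 t)) -> (forall t, is_derive f1 t (f2 t)) ->
  (forall t, continuous f2 t) -> (forall t, 0 <= t -> 0 < f2 t) -> 0 < L ->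
  exists G : curve,
    (forall t, cx G t = L * t - d) /\ (forall t, cy G t = f (L * t)) /\
    (forall t, cx' G t = L) /\ (forall t, cy' G t = L * f1 (L * t)) /\
    (forall t, cx'' G t = 0) /\ (forall t, cy'' G t = L ^ 2 * f2 (L * t)).
Proof.
intros d1 d2 c2 p2 L0.
assert (comp : forall g g' : R -> R, (forall t, is_derive g t (g' t)) ->
   forall t, is_derive (fun z => g (L * z)) t (L * g' (L * t))).
{ intros g g' H t. apply (is_derive_ext (fun z => g (L * z + 0))).
  - intro; now rewrite Rplus_0_r.
  - apply is_derive_comp_affine. rewrite Rplus_0_r. apply H. }
unshelve eexists (Curve (fun t => L * t - d) (fun t => f (L * t)) (fun _ => L)
  (fun t => L * f1 (L * t)) (fun _ => 0) (fun t => L ^ 2 * f2 (L * t)) _ _ _ _ _ _ _).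
8: repeat split; reflexivity.
- intros t _. apply D_in_I01_of_is_derive. auto_derive; [exact I | ring].
- intros t _. apply D_in_I01_of_is_derive, comp, d1.
- intros t _. apply D_in_I01_of_is_derive. apply (is_derive_const (V := R_NormedModule)).
- intros t _. apply D_in_I01_of_is_derive.
  replace (L ^ 2 * f2 (L * t)) with (L * (L * f2 (L * t))) by ring.
  apply is_derive_Rscal, comp, d2.
- intros t _. apply continue_in_I01_of_continuous, continuous_const.
- intros t _. apply continue_in_I01_of_continuous, continuity_pt_filterlim.
  apply (continuity_pt_scal (fun t => f2 (L * t))).
  apply (continuity_pt_comp (fun t => L * t) f2).
  + apply continuity_pt_filterlim, (ex_derive_continuous (fun t => L * t)). auto_derive. exact I.
  + apply continuity_pt_filterlim, c2.
- intros t [ht _]. cbv beta. assert (0 < f2 (L * t)) by (apply p2; nra).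
  assert (0 < L * (L ^ 2 * f2 (L * t))).
  { apply Rmult_lt_0_compat; [exact L0|]. apply Rmult_lt_0_compat; [apply pow_lt; exact L0 | assumption]. }
  lra.
Qed.

Lemma sqrt_1_sqr_mult (L z : R) : 0 < L -> sqrt (L ^ 2 + (L * z) ^ 2) = L * sqrt (1 + z ^ 2).
Proof.
intro h. replace (L ^ 2 + (L * z) ^ 2) with (L ^ 2 * (1 + z ^ 2)) by ring.
rewrite sqrt_mult by nra. now rewrite sqrt_pow2 by lra.
Qed.

(* The slope is at least [w] and increasing, so [f'' <= f''(0)] puts the maximum of
   the curvature [f'' / (1 + f' ^ 2) ^ (3 / 2)] at [0]. *)
Lemma profile_in_class (w r l eps X sigma d : R) (pts : list (Z * Z)) (f f1 f2 : R -> R) :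
  1 <= l -> l <= r -> 0 <= w <= 1 -> sigma <= 2 -> 3 * X <= l ->
  profile w (Rpower (1 + w ^ 2) (3 / 2) / r) eps X sigma d pts f f1 f2 ->
  exists G, in_class w l r G /\ forall p, In p pts -> lattice_points G p.
Proof.
intros hl hlr hw hs hX P.
set (k := Rpower (1 + w ^ 2) (3 / 2) / r) in *.
pose proof (pr_d1 _ _ _ _ _ _ _ _ _ _ P) as d1. pose proof (pr_d2 _ _ _ _ _ _ _ _ _ _ P) as d2.
pose proof (pr_c2 _ _ _ _ _ _ _ _ _ _ P) as c2. pose proof (pr_curv _ _ _ _ _ _ _ _ _ _ P) as p2.
pose proof (pr_slope0 _ _ _ _ _ _ _ _ _ _ P) as s0. pose proof (pr_curv0 _ _ _ _ _ _ _ _ _ _ P) as k0.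
pose proof (pr_X _ _ _ _ _ _ _ _ _ _ P) as X0.
destruct (pr_tail _ _ _ _ _ _ _ _ _ _ P X ltac:(lra)) as [_ [sX _]]. rewrite Rminus_diag, Rmult_0_r, Rplus_0_r in sX.
assert (mono : forall u t, 0 <= u <= t -> f1 u <= f1 t).
{ intros u t h. pose proof (increment_le (fun _ => 0) f1 (fun _ => 0) f2 u t ltac:(lra)) as H.
  simpl in H. enough (0 - 0 <= f1 t - f1 u) by lra. apply H; auto.
  - intros. apply (is_derive_const (V := R_NormedModule)).
  - intros z hz. left. apply p2. lra. }
set (v := fun t => sqrt (1 + f1 t ^ 2)).
assert (cv : forall t, continuous v t).
{ intro t. apply continuity_pt_filterlim. apply (continuity_pt_comp (fun t => 1 + f1 t ^ 2) sqrt).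
  - apply continuity_pt_filterlim. apply (ex_derive_continuous (fun t => 1 + f1 t ^ 2)).
    auto_derive. eexists; apply d2.
  - apply continuity_pt_sqrt. nra. }
set (F := fun z => RInt v 0 z : R).
assert (dF : forall z, is_derive F z (v z)) by apply (continuous_primitive v 0 cv).
assert (F0 : F 0 = 0) by (unfold F; rewrite RInt_point; reflexivity).
(* Slopes on [[0, X]] are at most 2, so the speed is at most 3 and the graph over [[0, X]] is not
   longer than [l]; over [[0, l]] it is not shorter. The right end [L] found between [X] and [l]
   thus keeps all marked points. *)
assert (FX : F X <= l).
{ pose proof (increment_le F (fun z => 3 * z) v (fun _ => 3) 0 X X0) as H.
  enough (F X - F 0 <= 3 * X - 3 * 0) by lra. apply H; auto.
  - intros; auto_derive; [exact I | ring].
  - intros z hz. unfold v. rewrite <- (sqrt_pow2 3) by lra. apply sqrt_le_1_alt.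
    pose proof (mono 0 z ltac:(lra)). pose proof (mono z X ltac:(lra)). nra. }
assert (Fl : l <= F l).
{ pose proof (increment_le (fun z => z) F (fun _ => 1) v 0 l ltac:(lra)) as H.
  enough (l - 0 <= F l - F 0) by lra. apply H; auto.
  - intros; auto_derive; [exact I | ring].
  - intros z hz. unfold v. rewrite <- sqrt_1 at 1. apply sqrt_le_1_alt. nra. }
destruct (IVT_gen F X l l) as [L [hL FL]].
{ intro z. apply continuity_pt_filterlim, (ex_derive_continuous F). eexists; apply dF. }
{ rewrite Rmin_left, Rmax_right; lra. }
rewrite Rmin_left, Rmax_right in hL by lra.
assert (L0 : 0 < L).
{ destruct (Req_dec L 0) as [e|]; [|lra]. rewrite e, F0 in FL. lra. }
destruct (graph_curve f f1 f2 L d d1 d2 c2 (fun t h => proj1 (p2 t h)) L0)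
  as [G [ex [ey [ex' [ey' [ex'' ey'']]]]]].
assert (R1 : forall t, I01 t -> curvature_radius G t = Rpower (1 + f1 (L * t) ^ 2) (3 / 2) / f2 (L * t)).
{ intros t [ht _]. unfold curvature_radius. rewrite ex', ey', ex'', ey''.
  assert (0 < f2 (L * t)) by (apply p2; nra).
  rewrite Rmult_0_l, Rminus_0_r, !Rpower_3_2 by nra. rewrite sqrt_1_sqr_mult by lra.
  assert (L * (L ^ 2 * f2 (L * t)) = L ^ 3 * f2 (L * t)) as -> by ring.
  assert (0 < L ^ 3) by (apply pow_lt; lra).
  rewrite Rabs_pos_eq by nra. field. lra. }
exists G. split.
- repeat split.
  + rewrite ey', Rmult_0_r, s0. nra.
  + rewrite ex', ey', Rmult_0_r, s0. nra.
  + unfold curve_length. rewrite <- FL. unfold F.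
    assert (C : ex_RInt v (L * 0 + 0) (L * 1 + 0)).
    { apply (ex_RInt_continuous (V := R_CompleteNormedModule)). intros; apply cv. }
    pose proof (RInt_comp_lin v L 0 0 1 C) as H.
    replace (L * 0 + 0) with 0 in H by ring. replace (L * 1 + 0) with L in H by ring.
    rewrite <- H. apply RInt_ext. intros t _. rewrite ex', ey', sqrt_1_sqr_mult, Rplus_0_r by lra.
    reflexivity.
  + exists 0. split; [unfold I01; lra|]. rewrite R1 by (unfold I01; lra).
    rewrite Rmult_0_r, s0, k0. unfold k. rewrite Rpower_3_2 by nra.
    assert (0 < sqrt (1 + w ^ 2)) by (apply sqrt_lt_R0; nra). field. lra.
  + intros z [t [ht ->]]. rewrite R1 by exact ht. destruct ht as [ht _].
    assert (Lt : 0 <= L * t) by nra. destruct (p2 _ Lt) as [q1 q2].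
    apply Rmult_le_reg_r with (f2 (L * t)); [exact q1|].
    unfold Rdiv. rewrite Rmult_assoc, Rinv_l, Rmult_1_r by lra.
    apply Rle_trans with (r * k); [apply Rmult_le_compat_l; lra|].
    unfold k. replace (r * (Rpower (1 + w ^ 2) (3 / 2) / r)) with (Rpower (1 + w ^ 2) (3 / 2)) by (field; lra).
    apply Rle_Rpower_l; [lra|]. pose proof (mono 0 (L * t) ltac:(lra)). rewrite s0 in *. split; nra.
  + unfold initial_slope. rewrite ex', ey', Rmult_0_r, s0. field. lra.
- intros p hp. destruct (pr_pts _ _ _ _ _ _ _ _ _ _ P p hp) as [b e].
  exists ((IZR (fst p) + d) / L).
  assert (E : L * ((IZR (fst p) + d) / L) = IZR (fst p) + d) by (field; lra).
  rewrite ex, ey, E. split; [|split; [ring | exact e]].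
  unfold I01. split.
  + apply Rmult_le_pos; [lra | left; now apply Rinv_0_lt_compat].
  + apply Rmult_le_reg_l with L; [exact L0|]. rewrite E. lra.
Qed.

Lemma Rpower_3_2_ge1 (w : R) : 1 <= Rpower (1 + w ^ 2) (3 / 2).
Proof.
rewrite Rpower_3_2 by nra. rewrite <- (pow1 3). apply pow_incr. split; [lra|].
rewrite <- sqrt_1 at 1. apply sqrt_le_1_alt. nra.
Qed.

(** * Chaining lattice points through an increasing list of fractions *)

Definition fraction_le (A z : R) : Prop :=
  exists a b : Z, (1 <= a)%Z /\ IZR a <= A /\ z = IZR b / IZR a.

(** The difference is a positive integer over a product of two denominators. This gap keeps the
    background [eps] from outweighing a slope step in [profile_append]. *)
Lemma fraction_gap (A z z' : R) : fraction_le A z -> fraction_le A z' -> z < z' -> 1 <= (z' - z) * A ^ 2.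
Proof.
intros [a [b [a1 [aA ->]]]] [a' [b' [a1' [aA' ->]]]] lt.
apply IZR_le in a1, a1'.
assert (E : IZR b' / IZR a' - IZR b / IZR a = (IZR b' * IZR a - IZR b * IZR a') / (IZR a * IZR a')) by (field; lra).
assert (N : 1 <= IZR b' * IZR a - IZR b * IZR a').
{ rewrite <- !mult_IZR, <- minus_IZR. apply (IZR_le 1).
  assert (0 < b' * a - b * a')%Z; [|lia]. apply lt_IZR. rewrite minus_IZR, !mult_IZR.
  assert (0 < (IZR b' / IZR a' - IZR b / IZR a) * (IZR a * IZR a')) by (apply Rmult_lt_0_compat; nra).
  rewrite E in H. field_simplify in H; lra. }
assert (M : IZR a * IZR a' <= A ^ 2) by nra.
assert (Q : (IZR b' / IZR a' - IZR b / IZR a) * (IZR a * IZR a') = IZR b' * IZR a - IZR b * IZR a') by (field; lra).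
assert (0 < IZR b' / IZR a' - IZR b / IZR a) by lra. nra.
Qed.

Lemma multiple_in_window (a : Z) (A E : R) : (1 <= a)%Z -> IZR a <= A -> 0 < E ->
  exists s : Z, (1 <= s)%Z /\ E <= IZR s * IZR a <= E + A.
Proof.
intros a1 aA E0. pose proof a1 as a1'. apply IZR_le in a1'.
destruct (archimed (E / IZR a)) as [h1 h2].
assert (e : E / IZR a * IZR a = E) by (field; lra).
assert (0 < E / IZR a) by (apply Rmult_lt_0_compat; [lra | apply Rinv_0_lt_compat; lra]).
exists (up (E / IZR a)). split; [|nra].
assert (0 < up (E / IZR a))%Z; [|lia]. apply lt_IZR. lra.
Qed.

(** The vector is [s * (a, b) + t * (a', b')], where [p = s * a] and [q = t * a'] both lie in
    [[E, E + A]]. As [E >= 2 * A], the weight [q / (p + q)] lies between 2/5 and 3/5; the other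
    lower bound on [E] makes the step long enough for the curvature to stay below [k]. *)
Lemma balanced_chord (r A z z' : R) : 0 < r -> 1 <= A ->
  fraction_le A z -> fraction_le A z' -> z < z' ->
  exists (dx dy : Z) (tau : R), (0 < dx)%Z /\ IZR dy = tau * IZR dx /\
    4 / 10 * (z' - z) <= tau - z <= 6 / 10 * (z' - z) /\
    3 * r * (z' - z) <= IZR dx <= 6 * A + 3 * r * (z' - z).
Proof.
intros r0 A1 [a [b [a1 [aA ez]]]] [a' [b' [a1' [aA' ez']]]] lt.
set (E := Rmax (2 * A) (3 / 2 * r * (z' - z))).
assert (rz : 0 < r * (z' - z)) by (apply Rmult_lt_0_compat; lra).
assert (E1 : 2 * A <= E) by apply Rmax_l.
assert (E2 : 3 / 2 * r * (z' - z) <= E) by apply Rmax_r.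
assert (E3 : E <= 2 * A + 3 / 2 * r * (z' - z)) by (apply Rmax_lub; lra).
destruct (multiple_in_window a A E) as [s [s1 hs]]; [assumption..|lra|].
destruct (multiple_in_window a' A E) as [t [t1 ht]]; [assumption..|lra|].
apply IZR_le in a1, a1'.
assert (eb : IZR b = z * IZR a) by (rewrite ez; field; lra).
assert (eb' : IZR b' = z' * IZR a') by (rewrite ez'; field; lra).
set (p := IZR s * IZR a) in *. set (q := IZR t * IZR a') in *.
assert (ed : IZR (s * a + t * a') = p + q) by now rewrite plus_IZR, !mult_IZR.
exists (s * a + t * a')%Z, (s * b + t * b')%Z, ((z * p + z' * q) / (p + q)).
rewrite ed. repeat split; try lra.
- apply lt_IZR. rewrite ed. lra.
- rewrite plus_IZR, !mult_IZR, eb, eb'. unfold p, q in *. field. lra.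
- replace ((z * p + z' * q) / (p + q) - z) with (q / (p + q) * (z' - z)) by (field; lra).
  apply Rmult_le_compat_r; [lra|]. apply Rmult_le_reg_r with (p + q); [lra|].
  replace (q / (p + q) * (p + q)) with q by (field; lra). lra.
- replace ((z * p + z' * q) / (p + q) - z) with (q / (p + q) * (z' - z)) by (field; lra).
  apply Rmult_le_compat_r; [lra|]. apply Rmult_le_reg_r with (p + q); [lra|].
  replace (q / (p + q) * (p + q)) with q by (field; lra). lra.
Qed.

(** The cost in abscissa telescopes: [6 * A] for each point, and [3 * r] times the total slope gain.
    The two conditions on [eps] make each of the two parts of the bound on [10 * eps * dx] at most
    half of the slope step. *)
Lemma profile_chain (w k eps r A : R) (L : list R) : 0 < r -> 1 <= A -> / r <= k -> 0 < eps ->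
  60 * eps * r <= 1 -> 120 * eps * A ^ 3 <= 1 ->
  forall X sigma d pts f f1 f2,
  profile w k eps X sigma d pts f f1 f2 -> fraction_le A sigma ->
  StronglySorted Rlt (sigma :: L) -> (forall z, In z L -> fraction_le A z) ->
  exists X' sigma' d' pts' f f1 f2, profile w k eps X' sigma' d' pts' f f1 f2 /\
    length pts' = (length L + length pts)%nat /\ In sigma' (sigma :: L) /\
    X' - X <= 6 * A * INR (length L) + 3 * r * (sigma' - sigma).
Proof.
intros r0 A1 rk e0 he1 he2. induction L as [|z L IH]; intros X sigma d pts f f1 f2 P fs SS hL.
- exists X, sigma, d, pts, f, f1, f2. split; [exact P|]. split; [reflexivity|].
  split; [now left | simpl; lra].
- inversion SS as [|? ? SS' all]; subst. inversion all as [|? ? lt _]; subst.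
  assert (fz : fraction_le A z) by (apply hL; now left).
  destruct (balanced_chord r A sigma z r0 A1 fs fz lt) as [dx [dy [tau [dx0 [hdy [mid [b1 b2]]]]]]].
  pose proof (fraction_gap A sigma z fs fz lt) as gap.
  assert (A3 : 6 * A * eps * 10 <= (z - sigma) / 2).
  { assert (0 < A ^ 2) by (apply pow_lt; lra).
    apply Rmult_le_reg_r with (A ^ 2); [assumption|].
    replace (6 * A * eps * 10 * A ^ 2) with (120 * eps * A ^ 3 / 2) by field. nra. }
  destruct (profile_append w k eps X sigma d pts f f1 f2 z tau dx dy P) as [p [g [g1 [g2 P']]]]; auto.
  + apply Rle_trans with (10 * eps * (6 * A + 3 * r * (z - sigma))).
    * apply Rmult_le_compat_l; lra.
    * assert (0 < z - sigma) by lra. nra.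
  + apply Rle_trans with (k * (3 * r * (z - sigma))).
    * assert (1 <= k * r). { replace 1 with (/ r * r) by (field; lra). apply Rmult_le_compat_r; lra. }
      assert (0 < z - sigma) by lra. nra.
    * apply Rmult_le_compat_l; [|lra]. pose proof (Rinv_0_lt_compat r r0). lra.
  + destruct (IH (X + IZR dx) z d (p :: pts) g g1 g2 P' fz SS') as
      [X' [s' [d' [pts' [h [h1 [h2 [Q [len [mem bd]]]]]]]]]].
    { intros; apply hL; now right. }
    exists X', s', d', pts', h, h1, h2. split; [exact Q|]. split; [simpl in *; lia|].
    split; [right; exact mem|]. simpl length. rewrite S_INR. lra.
Qed.

(** Of the third of [l] available to the marked points, one half pays for the slope gain,
    [3 * r * (l / r / 18) = l / 6], and one half for the points, [6 * A * INR (length L) <= l / 6].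
    With [L] empty the slope [sigma] need not be rational: this case provides a single lattice
    point. *)
Lemma curve_from_fractions (w r l A : R) (sigma : R) (L : list R) :
  1 <= l -> l <= r -> 0 <= w <= 1 -> 1 <= A ->
  w < sigma -> StronglySorted Rlt (sigma :: L) ->
  (forall z, In z (sigma :: L) -> z <= w + l / r / 18 /\ (L <> [] -> fraction_le A z)) ->
  36 * A * INR (length L) <= l ->
  exists G pts, in_class w l r G /\ NoDup pts /\ length pts = S (length L) /\
    forall p, In p pts -> lattice_points G p.
Proof.
intros hl hlr hw A1 ws SS hL hA.
set (k := Rpower (1 + w ^ 2) (3 / 2) / r).
assert (r0 : 0 < r) by lra. pose proof (Rinv_0_lt_compat r r0) as ir.
assert (rk : / r <= k).
{ unfold k, Rdiv. rewrite <- (Rmult_1_l (/ r)) at 1. apply Rmult_le_compat_r; [lra|]. apply Rpower_3_2_ge1. }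
assert (lr : l / r <= 1).
{ apply Rmult_le_reg_r with r; [lra|]. unfold Rdiv. rewrite Rmult_assoc, Rinv_l by lra. lra. }
assert (rlr : r * (l / r) = l) by (field; lra).
assert (A2 : 0 < A ^ 2) by (apply pow_lt; lra). assert (A3 : 1 <= A ^ 3) by (rewrite <- (pow1 3); apply pow_incr; lra).
pose (eps := / (120 * r * A ^ 3)).
assert (e0 : 0 < eps) by (apply Rinv_0_lt_compat; nra).
assert (ee : eps * (120 * r * A ^ 3) = 1) by (unfold eps; field; lra).
assert (X0 : forall X, X <= 2 * (sigma - w) / k -> X <= 3 * r * (sigma - w)).
{ intros X hX. eapply Rle_trans; [exact hX|]. unfold Rdiv.
  assert (/ k <= r). { rewrite <- (Rinv_inv r). apply Rinv_le_contravar; lra. }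
  assert (0 < sigma - w) by lra. nra. }
assert (r1 : 1 <= r) by lra.
assert (e60 : 60 * eps * r <= 1) by nra.
assert (eA : 120 * eps * A ^ 3 <= 1).
{ rewrite <- ee. assert (0 < eps * A ^ 3) by nra. nra. }
assert (ek : eps <= k).
{ apply Rle_trans with (/ r); [|exact rk]. unfold eps. apply Rinv_le_contravar; nra. }
destruct (profile_start w k eps sigma (conj e0 ek) ws) as [X [d [f [f1 [f2 [P hX]]]]]].
apply X0 in hX.
assert (fin : exists X' sigma' d' pts' f f1 f2, profile w k eps X' sigma' d' pts' f f1 f2 /\
    length pts' = S (length L) /\ In sigma' (sigma :: L) /\
    X' - X <= 6 * A * INR (length L) + 3 * r * (sigma' - sigma)).
{ destruct L as [|z L].
  - exists X, sigma, d, [(0, 0)%Z], f, f1, f2. split; [exact P|]. split; [reflexivity|].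
    split; [now left | simpl; lra].
  - destruct (profile_chain w k eps r A (z :: L) r0 A1 rk e0) with (X := X) (sigma := sigma) (d := d)
      (pts := [(0, 0)%Z]) (f := f) (f1 := f1) (f2 := f2) as [X' [s' [d' [pts' [h [h1 [h2 [Q [len [mem bd]]]]]]]]]]; auto.
    + apply hL; [now left | discriminate].
    + intros y hy. apply hL; [now right | discriminate].
    + exists X', s', d', pts', h, h1, h2. split; [exact Q|]. split; [rewrite len; simpl; lia|]. auto. }
destruct fin as [X' [s' [d' [pts' [h [h1 [h2 [Q [len [mem bd]]]]]]]]]].
destruct (hL s' mem) as [hs' _].
destruct (profile_in_class w r l eps X' s' d' pts' h h1 h2) as [G [inG latG]]; auto; try lra.
- assert (r * (s' - w) <= l / 18). { rewrite <- rlr. assert (s' - w <= l / r / 18) by lra. nra. }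
  nra.
- exists G, pts'. split; [exact inG|]. split; [|split; [exact len | exact latG]].
  apply (pr_nodup _ _ _ _ _ _ _ _ _ _ Q).
Qed.

(** * Fractions in short intervals *)

Lemma NoDup_list_prod {S T : Type} (l : list S) (l' : list T) :
  NoDup l -> NoDup l' -> NoDup (list_prod l l').
Proof.
intros nd nd'. induction nd as [|a l na nd IH]; simpl; [constructor|].
apply NoDup_app.
- apply FinFun.Injective_map_NoDup_in; [|exact nd']. intros x y _ _ e. now inversion e.
- exact IH.
- intros [x y] h1 h2. apply in_map_iff in h1. destruct h1 as [z [e _]]. inversion e; subst.
  apply in_prod_iff in h2. tauto.
Qed.

Definition coprime_pairs (n : nat) : list (nat * nat) :=
  filter (fun p => Nat.eqb (Nat.gcd (fst p) (snd p)) 1) (list_prod (seq 1 n) (seq 1 n)).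

Lemma in_coprime_pairs (n s t : nat) :
  In (s, t) (coprime_pairs n) <-> (1 <= s <= n /\ 1 <= t <= n)%nat /\ Nat.gcd s t = 1%nat.
Proof.
unfold coprime_pairs. rewrite filter_In, in_prod_iff, !in_seq. simpl. rewrite Nat.eqb_eq. lia.
Qed.

Lemma NoDup_coprime_pairs (n : nat) : NoDup (coprime_pairs n).
Proof. apply NoDup_filter, NoDup_list_prod; apply seq_NoDup. Qed.

(* Pairs with common divisor [d >= 2] number [(n / d) ^ 2], and the sum of [1 / d ^ 2]
   over [d >= 2] telescopes below [3 / 4]. *)
Lemma coprime_pairs_length (n : nat) : INR n ^ 2 / 4 <= INR (length (coprime_pairs n)).
Proof.
set (f := fun d : nat => map (fun p : nat * nat => (d * fst p, d * snd p)%nat)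
  (list_prod (seq 1 (n / d)) (seq 1 (n / d)))).
assert (fl : forall d, (1 <= d)%nat -> INR (length (f d)) <= INR n ^ 2 / INR d ^ 2).
{ intros d hd. unfold f. rewrite length_map, length_prod, !length_seq, mult_INR.
  assert (D : 1 <= INR d) by (apply (le_INR 1); exact hd).
  assert (INR (n / d) * INR d <= INR n).
  { rewrite <- mult_INR. apply le_INR. rewrite Nat.mul_comm. apply Nat.Div0.mul_div_le. }
  pose proof (pos_INR (n / d)). pose proof (pos_INR n).
  apply Rmult_le_reg_r with (INR d ^ 2); [nra|].
  replace (INR n ^ 2 / INR d ^ 2 * INR d ^ 2) with (INR n ^ 2) by (field; lra).
  replace (INR (n / d) * INR (n / d) * INR d ^ 2) with ((INR (n / d) * INR d) ^ 2) by ring.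
  apply pow_incr. split; [apply Rmult_le_pos; lra | assumption]. }
assert (tot : forall k, INR (length (flat_map f (seq 2 (S k)))) <= INR n ^ 2 * (3 / 4 - / INR (S (S k)))).
{ induction k as [|k IH].
  - simpl seq. simpl flat_map. rewrite app_nil_r. eapply Rle_trans; [apply fl; lia|].
    simpl. right. field.
  - rewrite seq_S, flat_map_app, length_app, plus_INR. simpl (flat_map f [_]). rewrite app_nil_r.
    eapply Rle_trans; [apply Rplus_le_compat; [exact IH | apply fl; lia]|].
    replace (2 + S k)%nat with (S (S (S k))) by lia.
    rewrite (S_INR (S (S k))). assert (K : 1 <= INR (S (S k))) by (apply (le_INR 1); lia).
    set (x := INR (S (S k))) in *. unfold Rdiv at 2. rewrite <- Rmult_plus_distr_l.
    apply Rmult_le_compat_l; [apply pow2_ge_0|].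
    assert (/ (x + 1) ^ 2 <= / x - / (x + 1)); [|lra].
    replace (/ x - / (x + 1)) with (/ (x * (x + 1))) by (field; lra).
    apply Rinv_le_contravar; nra. }
destruct n as [|[|n]].
- simpl. lra.
- simpl. lra.
- specialize (tot n).
  assert (inc : (length (list_prod (seq 1 (S (S n))) (seq 1 (S (S n))))
    <= length (coprime_pairs (S (S n)) ++ flat_map f (seq 2 (S n))))%nat).
  { apply NoDup_incl_length; [apply NoDup_list_prod; apply seq_NoDup|].
    intros [s t] h. apply in_prod_iff in h. rewrite !in_seq in h. apply in_or_app.
    destruct (Nat.eq_dec (Nat.gcd s t) 1) as [e|ne].
    - left. apply in_coprime_pairs. lia.
    - right. apply in_flat_map. exists (Nat.gcd s t).
      destruct (Nat.gcd_divide_l s t) as [i hi]. destruct (Nat.gcd_divide_r s t) as [j hj].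
      set (g := Nat.gcd s t) in *.
      assert (g <> 0)%nat by (intro E; rewrite E in hi; lia).
      assert (i <> 0)%nat by (intro E; rewrite E in hi; lia).
      assert (j <> 0)%nat by (intro E; rewrite E in hj; lia).
      assert (g <= s)%nat by nia.
      split; [apply in_seq; lia|]. unfold f. apply in_map_iff. exists (i, j). simpl.
      split; [f_equal; lia|]. apply in_prod_iff. rewrite !in_seq.
      assert (i <= S (S n) / g)%nat by (apply Nat.div_le_lower_bound; lia).
      assert (j <= S (S n) / g)%nat by (apply Nat.div_le_lower_bound; lia). lia. }
  rewrite length_prod, length_seq, length_app in inc. apply le_INR in inc.
  rewrite mult_INR, plus_INR in inc.
  assert (0 < / INR (S (S n))) by (apply Rinv_0_lt_compat, lt_0_INR; lia).
  assert (0 <= INR (S (S n)) ^ 2) by apply pow2_ge_0. nra.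
Qed.

Lemma delta_le (w x : R) (a b : Z) : 0 < x -> (1 <= a)%Z ->
  delta w x <= IZR a * x + Rabs (IZR b - IZR a * w).
Proof.
intros x0 a1. destruct (delta_min w x x0) as [_ H].
assert (E : INR (Z.to_nat a) = IZR a) by (rewrite INR_IZR_INZ, Z2Nat.id by lia; reflexivity).
apply Rle_trans with (INR (Z.to_nat a) * x + dist_int (INR (Z.to_nat a) * w)).
- apply H. exists (Z.to_nat a). split; [lia | reflexivity].
- rewrite E. apply Rplus_le_compat_l. rewrite Rabs_minus_sym. apply dist_int_le.
Qed.

Lemma delta_witness (w x : R) : 0 < x ->
  exists q p : Z, (1 <= q)%Z /\ delta w x = IZR q * x + Rabs (IZR p - IZR q * w).
Proof.
intro x0. destruct (delta_min w x x0) as [[q [q1 E]] _].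
destruct (dist_int_witness (INR q * w)) as [p hp].
exists (Z.of_nat q), p. split; [lia|].
now rewrite E, <- hp, <- INR_IZR_INZ, Rabs_minus_sym.
Qed.

Lemma delta_gt0 (w x : R) : 0 < x -> 0 < delta w x.
Proof.
intro x0. destruct (delta_witness w x x0) as [q [p [q1 ->]]]. apply IZR_le in q1.
pose proof (Rabs_pos (IZR p - IZR q * w)). nra.
Qed.

Lemma nearest_integer (z : R) : exists k : Z, Rabs (z - IZR k) <= 1 / 2.
Proof.
destruct (dist_int_witness z) as [k hk]. exists k. rewrite hk. apply dist_int_le_half.
Qed.

(** * The plane lattice behind [delta] *)

Section ShortVector.

Context (w y : R) (y0 : 0 < y) (y1 : y <= 1 / 18).

(** The l1 norm of the vector [(a * y, b - a * w)] of a lattice of covolume [y]. By the next lemma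
    and [delta_witness], [delta w y] is the length of a shortest nonzero vector. *)
Let N (a b : Z) := Rabs (IZR a * y) + Rabs (IZR b - IZR a * w).

(** Vectors with [a < 0] are handled by symmetry. Those with [a = 0] have norm at least 1, while the
    denominator 1 already gives [delta w y <= y + 1 / 2]. *)
Lemma delta_le_norm (a b : Z) : (a <> 0 \/ b <> 0)%Z -> delta w y <= N a b.
Proof.
intro ab. unfold N. destruct (Z.lt_trichotomy a 0) as [h|[->|h]].
- assert (a1 : (1 <= - a)%Z) by lia.
  pose proof (delta_le w y (- a) (- b) y0 a1) as H. rewrite !opp_IZR in H.
  replace (- IZR b - - IZR a * w) with (- (IZR b - IZR a * w)) in H by ring.
  rewrite Rabs_Ropp in H. rewrite Rabs_left1; [lra|]. apply IZR_lt in h. nra.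
- rewrite Rmult_0_l, Rmult_0_l, Rabs_R0, Rminus_0_r, <- abs_IZR.
  assert (B1 : 1 <= IZR (Z.abs b)) by (apply (IZR_le 1); lia).
  destruct (nearest_integer w) as [k hk]. pose proof (delta_le w y 1 k y0 ltac:(lia)) as H.
  rewrite Rabs_minus_sym in hk. rewrite !Rmult_1_l in H. lra.
- pose proof (delta_le w y a b y0 ltac:(lia)) as H. rewrite (Rabs_pos_eq (IZR a * y)); [exact H|].
  apply IZR_lt in h. nra.
Qed.

(** A common factor of [q] and [p] could be divided out, giving a strictly shorter vector; Bezout
    then completes [(q, p)] to a basis. *)
Lemma short_vector_primitive (q p : Z) : (1 <= q)%Z ->
  delta w y = IZR q * y + Rabs (IZR p - IZR q * w) -> exists a b : Z, (q * b - p * a = 1)%Z.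
Proof.
intros q1 E.
destruct (Z.gcd_divide_l q p) as [q' hq]. destruct (Z.gcd_divide_r q p) as [p' hp].
assert (g0 := Z.gcd_nonneg q p).
destruct (Z.gcd_bezout q p _ eq_refl) as [u [v huv]].
set (g := Z.gcd q p) in *.
assert (g1 : (1 <= g)%Z). { destruct (Z.eq_dec g 0) as [e|]; [|lia]. rewrite e in hq. lia. }
assert (g = 1)%Z as G.
{ assert (q'1 : (1 <= q')%Z) by nia.
  pose proof (delta_le w y q' p' y0 q'1) as H. rewrite E, hq, hp, !mult_IZR in H.
  replace (IZR p' * IZR g - IZR q' * IZR g * w) with ((IZR p' - IZR q' * w) * IZR g) in H by ring.
  apply IZR_le in q'1. apply IZR_le in g1. rewrite Rabs_mult, (Rabs_pos_eq (IZR g)) in H by lra.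
  pose proof (Rabs_pos (IZR p' - IZR q' * w)).
  set (M := IZR q' * y + Rabs (IZR p' - IZR q' * w)) in *.
  assert (0 < M) by (unfold M; nra).
  assert (Gle : IZR g <= 1) by (apply Rmult_le_reg_r with M; unfold M in *; nra).
  apply le_IZR in Gle. apply le_IZR in g1. lia. }
exists (- v)%Z, u. rewrite G in huv. lia.
Qed.

(* Gauss reduction: subtract a multiple of the short vector from the complementary one. *)
Lemma delta_sqr_le : delta w y ^ 2 <= 4 * y.
Proof.
destruct (delta_witness w y y0) as [q [p [q1 E]]].
destruct (short_vector_primitive q p q1 E) as [a [b ab]].
pose proof (delta_gt0 w y y0) as d0.
set (X1 := IZR q * y) in *. set (Y1 := IZR p - IZR q * w) in *.
set (X2 := IZR a * y). set (Y2 := IZR b - IZR a * w). set (D := delta w y) in *.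
assert (det : X1 * Y2 - Y1 * X2 = y).
{ replace (X1 * Y2 - Y1 * X2) with (y * (IZR q * IZR b - IZR p * IZR a)) by (unfold X1, X2, Y1, Y2; ring).
  rewrite <- !mult_IZR, <- minus_IZR, ab. ring. }
assert (nrm : forall k : Z, D <= Rabs (X2 - IZR k * X1) + Rabs (Y2 - IZR k * Y1)).
{ intro k.
  assert (nz : (a - k * q <> 0 \/ b - k * p <> 0)%Z).
  { destruct (Z.eq_dec (a - k * q) 0) as [h1|]; [|now left]. right. intro h2.
    replace a with (k * q)%Z in ab by lia. replace b with (k * p)%Z in ab by lia. nia. }
  pose proof (delta_le_norm _ _ nz) as H. unfold N in H. rewrite !minus_IZR, !mult_IZR in H.
  replace ((IZR a - IZR k * IZR q) * y) with (X2 - IZR k * X1) in H by (unfold X1, X2; ring).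
  replace (IZR b - IZR k * IZR p - (IZR a - IZR k * IZR q) * w) with (Y2 - IZR k * Y1) in H
    by (unfold Y1, Y2; ring). exact H. }
assert (X10 : 0 < X1) by (apply IZR_le in q1; unfold X1; nra).
(* [U] is the larger coordinate of the short vector. Rounding [Z1 / U] leaves at most [U / 2] in
   that coordinate, and the determinant [y] controls the other one; then [U * D <= 2 * y], while
   [U >= D / 2]. The sign [e] below makes [U] positive when the coordinates are exchanged. *)
assert (main : forall U V Z1 Z2, 0 < U -> U + Rabs V = D -> Rabs V <= U -> Rabs (U * Z2 - V * Z1) = y ->
   (forall k : Z, D <= Rabs (Z1 - IZR k * U) + Rabs (Z2 - IZR k * V)) -> D ^ 2 <= 4 * y).
{ intros U V Z1 Z2 U0 UV VU dt H.
  destruct (nearest_integer (Z1 / U)) as [k hk]. specialize (H k).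
  assert (B1 : Rabs (Z1 - IZR k * U) <= U / 2).
  { replace (Z1 - IZR k * U) with ((Z1 / U - IZR k) * U) by (field; lra).
    rewrite Rabs_mult, (Rabs_pos_eq U) by lra. nra. }
  assert (B2 : U * Rabs (Z2 - IZR k * V) <= y + Rabs V * (U / 2)).
  { rewrite <- (Rabs_pos_eq U) at 1 by lra. rewrite <- Rabs_mult.
    replace (U * (Z2 - IZR k * V)) with ((U * Z2 - V * Z1) + V * (Z1 - IZR k * U)) by ring.
    eapply Rle_trans; [apply Rabs_triang|]. rewrite dt, Rabs_mult. apply Rplus_le_compat_l.
    apply Rmult_le_compat_l; [apply Rabs_pos | exact B1]. }
  assert (U * D <= U * (D / 2) + y) by nra. nra. }
destruct (Rle_lt_dec (Rabs Y1) X1) as [c|c].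
- apply (main X1 Y1 X2 Y2); auto. rewrite det. apply Rabs_pos_eq; lra.
- assert (sg : exists e : Z, Rabs (IZR e) = 1 /\ IZR e * Y1 = Rabs Y1).
  { destruct (Rle_lt_dec 0 Y1).
    - exists 1%Z. rewrite Rabs_R1, Rabs_pos_eq by assumption. lra.
    - exists (-1)%Z. rewrite (Rabs_left (IZR (-1))), (Rabs_left Y1) by lra. lra. }
  destruct sg as [e [ae eY]].
  apply (main (IZR e * Y1) (IZR e * X1) Y2 X2).
  + lra.
  + rewrite Rabs_mult, ae, eY, (Rabs_pos_eq X1) by lra. lra.
  + rewrite Rabs_mult, ae, eY, (Rabs_pos_eq X1) by lra. lra.
  + replace (IZR e * Y1 * X2 - IZR e * X1 * Y2) with (IZR e * - (X1 * Y2 - Y1 * X2)) by ring.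
    rewrite det, Rabs_mult, ae, Rabs_Ropp, Rabs_pos_eq; lra.
  + intro k. specialize (nrm (k * e)%Z). rewrite mult_IZR in nrm.
    rewrite <- !Rmult_assoc. lra.
Qed.

(** Each admissible [h] stands for the fraction [(h * p + b) / (h * q + a)] in [(w, w + y]], of
    denominator at most [60 / D]. The nonzero determinant will separate the fractions built from
    neighbours. *)
Definition cone_family (D : R) (q p a b : Z) (c : R) : Prop :=
  (q * b - p * a <> 0)%Z /\
  forall h : Z, 0 < IZR h - c < 12 * y / D ^ 2 ->
    0 < IZR (h * p + b) - IZR (h * q + a) * w <= IZR (h * q + a) * y /\
    IZR (h * q + a) * D <= 60.

(* With [e1 = (q, p)] shortest and [det (e1, e2) = 1], one of the two lines
   [+- 12 e2 + R e1] meets the cone [0 < Y <= X] near the origin in a segment at least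
   [12 y / D ^ 2] steps of [e1] long; [12 y / D ^ 2 >= 3]. *)
Lemma cone_family_exists : exists (q p a b : Z) (c : R), cone_family (delta w y) q p a b c.
Proof.
destruct (delta_witness w y y0) as [q [p [q1 E]]].
destruct (short_vector_primitive q p q1 E) as [a [b ab]].
pose proof (delta_gt0 w y y0) as d0.
set (X1 := IZR q * y) in *. set (Y1 := IZR p - IZR q * w) in *.
set (X2 := IZR a * y). set (Y2 := IZR b - IZR a * w). set (D := delta w y) in *.
assert (det : X1 * Y2 - Y1 * X2 = y).
{ replace (X1 * Y2 - Y1 * X2) with (y * (IZR q * IZR b - IZR p * IZR a)) by (unfold X1, X2, Y1, Y2; ring).
  rewrite <- !mult_IZR, <- minus_IZR, ab. ring. }
assert (X10 : 0 < X1) by (apply IZR_le in q1; unfold X1; nra).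
set (m := y / D). assert (m0 : 0 < m) by (apply Rmult_lt_0_compat; [lra | now apply Rinv_0_lt_compat]).
assert (lam : forall z c, 0 <= c <= D -> 0 < z < 12 * y / D ^ 2 -> 0 <= z * c /\ z * c < 12 * m).
{ intros z c hc hz. split; [nra|].
  assert (12 * y / D ^ 2 * D = 12 * m) by (unfold m; field; lra). nra. }
assert (inv : forall Z, 0 < Z <= D -> m <= y / Z).
{ intros Z hZ. unfold m, Rdiv. apply Rmult_le_compat_l; [lra|]. apply Rinv_le_contravar; lra. }
assert (mD : m * D = y) by (unfold m; field; lra).
assert (fin : forall x, x * y <= 60 * m -> x * D <= 60).
{ intros x hx. apply Rmult_le_reg_r with m; [exact m0|]. replace (x * D * m) with (x * y) by (rewrite <- mD; ring). exact hx. }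
(* If [e1] is steep enough, [- 12 e2 + R e1] enters the cone through [Y = 0]; otherwise
   [X1 - Y1 >= D / 2] and [12 e2 + R e1] enters through [Y = X]. In both cases [z] counts steps from
   the entry point. The bound 60 is [12 + 4 * 12], from the first case. *)
destruct (Rle_lt_dec (D / 4) Y1) as [c|c].
- rewrite Rabs_pos_eq in E by lra.
  exists q, p, (- 12 * a)%Z, (- 12 * b)%Z, (12 * Y2 / Y1). split; [lia|].
  intros h hh. set (z := IZR h - 12 * Y2 / Y1) in *.
  assert (eY : IZR (h * p + - 12 * b) - IZR (h * q + - 12 * a) * w = z * Y1).
  { rewrite !plus_IZR, !mult_IZR. unfold z.
    replace ((IZR h - 12 * Y2 / Y1) * Y1) with (IZR h * Y1 - 12 * Y2) by (field; lra).
    unfold Y1, Y2. ring. }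
  assert (eX : IZR (h * q + - 12 * a) * y = z * X1 + 12 * (y / Y1)).
  { rewrite !plus_IZR, !mult_IZR. rewrite <- det at 2. unfold z.
    replace ((IZR h - 12 * Y2 / Y1) * X1 + 12 * ((X1 * Y2 - Y1 * X2) / Y1)) with (IZR h * X1 - 12 * X2) by (field; lra).
    unfold X1, X2. ring. }
  destruct (lam z X1 ltac:(lra) hh) as [l1 l2]. destruct (lam z Y1 ltac:(lra) hh) as [l3 l4].
  pose proof (inv Y1 ltac:(lra)) as iY.
  assert (y / Y1 <= 4 * m).
  { apply Rmult_le_reg_r with Y1; [lra|]. replace (y / Y1 * Y1) with y by (field; lra). nra. }
  rewrite eY. rewrite eX. split; [split; [apply Rmult_lt_0_compat; lra | lra]|].
  apply fin. rewrite eX. lra.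
- assert (dXY : D / 2 <= X1 - Y1 <= D).
  { revert E. unfold Rabs. destruct Rcase_abs; intro; lra. }
  set (W := X1 - Y1) in *.
  exists q, p, (12 * a)%Z, (12 * b)%Z, (- 12 * (X2 - Y2) / W). split; [lia|].
  intros h hh. set (z := IZR h - - 12 * (X2 - Y2) / W) in *.
  assert (eY : IZR (h * p + 12 * b) - IZR (h * q + 12 * a) * w = z * Y1 + 12 * (y / W)).
  { rewrite !plus_IZR, !mult_IZR. rewrite <- det. unfold z.
    replace ((IZR h - - 12 * (X2 - Y2) / W) * Y1 + 12 * ((X1 * Y2 - Y1 * X2) / W))
      with (IZR h * Y1 + 12 * Y2) by (unfold W in *; field; lra).
    unfold Y1, Y2. ring. }
  assert (eX : IZR (h * q + 12 * a) * y = z * X1 + 12 * (y / W)).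
  { rewrite !plus_IZR, !mult_IZR. rewrite <- det at 2. unfold z.
    replace ((IZR h - - 12 * (X2 - Y2) / W) * X1 + 12 * ((X1 * Y2 - Y1 * X2) / W))
      with (IZR h * X1 + 12 * X2) by (unfold W in *; field; lra).
    unfold X1, X2. ring. }
  destruct (lam z X1) as [l1 l2]; [pose proof (Rabs_pos Y1); lra | exact hh|].
  destruct (lam z (Rabs Y1)) as [l3 l4]; [pose proof (Rabs_pos Y1); lra | exact hh|].
  pose proof (inv W ltac:(lra)) as iW.
  assert (y / W <= 2 * m).
  { apply Rmult_le_reg_r with W; [lra|]. replace (y / W * W) with y by (field; lra). nra. }
  rewrite eY, eX. split; [split|].
  + assert (- Rabs Y1 <= Y1) by (unfold Rabs; destruct Rcase_abs; lra).
    assert (z * - Rabs Y1 <= z * Y1) by (apply Rmult_le_compat_l; lra). lra.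
  + apply Rplus_le_compat_r, Rmult_le_compat_l; [lra|]. unfold W in dXY. lra.
  + apply fin. rewrite eX. lra.
Qed.

(** The run has [m + 1] integers, hence [m] pairs of neighbours, the objects counted later. *)
Lemma integer_run (c z : R) : 3 <= z ->
  exists (h0 : Z) (m : nat), z / 3 <= INR m /\
    forall i : nat, (i <= m)%nat -> 0 < IZR (h0 + Z.of_nat i) - c < z.
Proof.
intro hz. destruct (archimed c) as [c1 c2]. destruct (archimed (z - 2)) as [u1 u2].
set (k := (up (z - 2) - 1)%Z).
assert (k0 : (0 <= k)%Z).
{ assert (1 < up (z - 2))%Z; [apply lt_IZR; lra | unfold k; lia]. }
(* For integral [z - 2] and [c], one more step from [up c = c + 1] would reach the excluded end
   [c + z]. *)
destruct (Req_dec (IZR k) (z - 2)) as [e|ne].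
- exists (up c), (Z.to_nat k).
  assert (ek : INR (Z.to_nat k) = IZR k) by (rewrite INR_IZR_INZ, Z2Nat.id; auto).
  split; [lra|]. intros i hi. apply le_INR in hi. rewrite plus_IZR, <- INR_IZR_INZ.
  pose proof (pos_INR i). lra.
- exists (up c), (Z.to_nat (k + 1)).
  assert (ek : INR (Z.to_nat (k + 1)) = IZR k + 1) by (rewrite INR_IZR_INZ, Z2Nat.id, plus_IZR by lia; reflexivity).
  assert (IZR k = IZR (up (z - 2)) - 1) by (unfold k; now rewrite minus_IZR).
  split; [lra|]. intros i hi. apply le_INR in hi. rewrite plus_IZR, <- INR_IZR_INZ.
  pose proof (pos_INR i). lra.
Qed.

(** The number [h + t / (s + t)] has integer part [h], and its fractional part determines [t / s],
    which is in lowest terms. *)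
Lemma barycentric_inj (h h' s t s' t' : nat) :
  (1 <= s)%nat -> (1 <= t)%nat -> (1 <= s')%nat -> (1 <= t')%nat ->
  Nat.gcd s t = 1%nat -> Nat.gcd s' t' = 1%nat ->
  ((h * (s + t) + t) * (s' + t') = (h' * (s' + t') + t') * (s + t))%nat ->
  h = h' /\ s = s' /\ t = t'.
Proof.
intros s1 t1 s1' t1' g g' e.
assert (hh : h = h').
{ destruct (Nat.lt_trichotomy h h') as [lt|[eq|lt]]; [exfalso|exact eq|exfalso].
  - assert ((h + 1) * (s + t) <= h' * (s + t))%nat by (apply Nat.mul_le_mono_r; lia). nia.
  - assert ((h' + 1) * (s' + t') <= h * (s' + t'))%nat by (apply Nat.mul_le_mono_r; lia). nia. }
subst h'. split; [reflexivity|].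
assert (e' : (t * s' = t' * s)%nat) by nia.
assert (d1 : Nat.divide s s').
{ apply (Nat.gauss s t s'); [exists t'; exact e' | exact g]. }
assert (d2 : Nat.divide s' s).
{ apply (Nat.gauss s' t' s); [exists t; lia | exact g']. }
assert (s = s') by (apply Nat.divide_antisym; assumption).
split; [assumption|]. subst s'. nia.
Qed.

(** Between consecutive vectors of the cone family, every combination with positive coprime
    coefficients [s, t <= S] stays in the cone. There are at least [4 * y / D ^ 2] pairs of
    neighbours and [(A * D / 240) ^ 2 / 4] pairs of coefficients; [D] cancels in the product. *)
Lemma many_fractions (A : R) : 120 <= A * delta w y ->
  exists L : list R, NoDup L /\ y * A ^ 2 / 57600 <= INR (length L) /\
    forall z, In z L -> w < z <= w + y /\ fraction_le A z.
Proof.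
intro hA. set (D := delta w y) in *.
assert (d0 : 0 < D) by now apply delta_gt0.
pose proof delta_sqr_le as dsq. fold D in dsq.
destruct cone_family_exists as [q [p [a [b [c [nz cone]]]]]]. fold D in cone.
assert (lam : 3 <= 12 * y / D ^ 2).
{ apply Rmult_le_reg_r with (D ^ 2); [nra|]. unfold Rdiv. rewrite Rmult_assoc, Rinv_l by nra. lra. }
destruct (integer_run c _ lam) as [h0 [m [hm run]]].
(* Denominators are at most [2 * S * 60 / D], hence this [S]. It is at least 1 by hypothesis, so
   rounding loses at most a factor 2. *)
destruct (nfloor_ex (A * D / 120)) as [S [S1 S2]]; [lra|].
assert (Shalf : A * D / 240 <= INR S).
{ destruct S as [|S]; [simpl in *; lra|]. pose proof (pos_INR S). rewrite S_INR in *. lra. }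
set (num := fun g : Z * Z => fun x : nat * (nat * nat) =>
  (Z.of_nat (fst (snd x)) * ((h0 + Z.of_nat (fst x)) * fst g + snd g)
   + Z.of_nat (snd (snd x)) * ((h0 + Z.of_nat (1 + fst x)) * fst g + snd g))%Z).
set (val := fun x => IZR (num (p, b) x) / IZR (num (q, a) x)).
set (I := list_prod (seq 0 m) (coprime_pairs S)).
assert (spec : forall x, In x I ->
  0 < IZR (num (p, b) x) - IZR (num (q, a) x) * w <= IZR (num (q, a) x) * y /\ IZR (num (q, a) x) <= A).
{ intros [i [s t]] hx. apply in_prod_iff in hx. destruct hx as [hi hst].
  apply in_seq in hi. apply in_coprime_pairs in hst. destruct hst as [[hs ht] _].
  destruct (cone _ (run i ltac:(lia))) as [u1 u2].
  destruct (cone _ (run (1 + i)%nat ltac:(lia))) as [v1 v2].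
  unfold num; simpl fst; simpl snd.
  set (Ai := ((h0 + Z.of_nat i) * q + a)%Z) in *. set (Bi := ((h0 + Z.of_nat i) * p + b)%Z) in *.
  set (Aj := ((h0 + Z.of_nat (1 + i)) * q + a)%Z) in *. set (Bj := ((h0 + Z.of_nat (1 + i)) * p + b)%Z) in *.
  rewrite !plus_IZR, !mult_IZR, <- !INR_IZR_INZ.
  assert (s1 : 1 <= INR s) by (apply (le_INR 1); lia). assert (t1 : 1 <= INR t) by (apply (le_INR 1); lia).
  assert (sS : INR s <= INR S) by (apply le_INR; lia). assert (tS : INR t <= INR S) by (apply le_INR; lia).
  assert (0 < IZR Ai) by nra. assert (0 < IZR Aj) by nra.
  split; [split|].
  - assert (0 < INR s * (IZR Bi - IZR Ai * w)) by (apply Rmult_lt_0_compat; lra).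
    assert (0 < INR t * (IZR Bj - IZR Aj * w)) by (apply Rmult_lt_0_compat; lra). lra.
  - assert (INR s * (IZR Bi - IZR Ai * w) <= INR s * (IZR Ai * y)) by (apply Rmult_le_compat_l; lra).
    assert (INR t * (IZR Bj - IZR Aj * w) <= INR t * (IZR Aj * y)) by (apply Rmult_le_compat_l; lra). lra.
  - apply Rmult_le_reg_r with D; [exact d0|].
    assert (INR s * (IZR Ai * D) <= INR S * 60) by (apply Rmult_le_compat; nra).
    assert (INR t * (IZR Aj * D) <= INR S * 60) by (apply Rmult_le_compat; nra). lra. }
assert (pos : forall x, In x I -> 0 < IZR (num (q, a) x)) by (intros x hx; destruct (spec x hx); nra).
exists (map val I). split; [|split].
- apply FinFun.Injective_map_NoDup_in; [|apply NoDup_list_prod; [apply seq_NoDup | apply NoDup_coprime_pairs]].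
  intros x x' hx hx' e. pose proof (pos x hx) as px. pose proof (pos x' hx') as px'.
  assert (cr : (num (p, b) x * num (q, a) x' = num (p, b) x' * num (q, a) x)%Z).
  { apply eq_IZR. rewrite !mult_IZR. unfold val in e.
    apply (Rmult_eq_compat_r (IZR (num (q, a) x) * IZR (num (q, a) x'))) in e. field_simplify in e; lra. }
  destruct x as [i [s t]], x' as [i' [s' t']].
  apply in_prod_iff in hx, hx'. destruct hx as [_ hx], hx' as [_ hx'].
  apply in_coprime_pairs in hx, hx'.
  unfold num in cr; simpl fst in cr; simpl snd in cr.
  (* Up to sign, the cross difference in [cr] is the determinant [q * b - p * a] times that of the
     positions [i + t / (s + t)], so the determinant can be cancelled. *)
  assert (key : ((i * (s + t) + t) * (s' + t') = (i' * (s' + t') + t') * (s + t))%nat).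
  { apply Nat2Z.inj. rewrite !Nat2Z.inj_mul, !Nat2Z.inj_add, !Nat2Z.inj_mul, !Nat2Z.inj_add.
    rewrite !Nat2Z.inj_add in cr. simpl (Z.of_nat 1) in cr.
    apply Z.mul_reg_l with (q * b - p * a)%Z; [exact nz|].
    apply Z.sub_move_0_r. apply Z.sub_move_0_r in cr. rewrite <- Z.opp_0, <- cr. ring. }
  destruct (barycentric_inj i i' s t s' t') as [-> [-> ->]]; try tauto; lia.
- rewrite length_map. unfold I. rewrite length_prod, length_seq, mult_INR.
  pose proof (coprime_pairs_length S) as cp.
  assert (Sq : (A * D / 240) ^ 2 <= INR S ^ 2) by (apply pow_incr; lra).
  apply Rle_trans with (12 * y / D ^ 2 / 3 * ((A * D / 240) ^ 2 / 4)).
  + right. field. lra.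
  + apply Rmult_le_compat; try lra. nra.
- intros z hz. apply in_map_iff in hz. destruct hz as [x [<- hx]].
  pose proof (pos x hx) as px. destruct (spec x hx) as [[s1 s2] s3]. unfold val.
  set (n := IZR (num (p, b) x)) in *. split.
  + split; apply Rmult_lt_reg_r with (IZR (num (q, a) x)) || apply Rmult_le_reg_r with (IZR (num (q, a) x)); auto;
      unfold Rdiv; rewrite Rmult_assoc, Rinv_l by lra; lra.
  + exists (num (q, a) x), (num (p, b) x). split; [|split; [exact s3 | reflexivity]].
    assert (0 < num (q, a) x)%Z; [apply lt_IZR; exact px | lia].
Qed.

End ShortVector.

(** * The two bounds *)

Lemma insert_sorted (a : R) (L : list R) : StronglySorted Rlt L -> ~ In a L ->
  exists L', Permutation (a :: L) L' /\ StronglySorted Rlt L'.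
Proof.
intros SS. induction SS as [|b L SS IH all]; intro na.
- exists [a]. split; [apply Permutation_refl | repeat constructor].
- destruct (Rtotal_order a b) as [lt|[->|gt]].
  + exists (a :: b :: L). split; [apply Permutation_refl|].
    constructor; [now constructor|]. constructor; [exact lt|].
    revert all. apply Forall_impl. intros; lra.
  + exfalso; apply na; now left.
  + destruct IH as [L' [P SS']]; [intro; apply na; now right|].
    exists (b :: L'). split.
    * apply perm_trans with (b :: a :: L); [apply perm_swap | now constructor].
    * constructor; [exact SS'|]. apply (Permutation_Forall P). now constructor.
Qed.

Lemma sorted_permutation (L : list R) : NoDup L ->
  exists L', Permutation L L' /\ StronglySorted Rlt L'.
Proof.
induction 1 as [|a L na nd [L' [P SS]]].
- exists []. split; constructor.
- destruct (insert_sorted a L' SS) as [L'' [P' SS']].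
  + intro h. apply na. now apply (Permutation_in a (Permutation_sym P)).
  + exists L''. split; [|exact SS']. apply perm_trans with (a :: L'); [now constructor | exact P'].
Qed.

Lemma StronglySorted_firstn (n : nat) (L : list R) :
  StronglySorted Rlt L -> StronglySorted Rlt (firstn n L).
Proof.
intro SS. revert n. induction SS as [|b L SS IH all]; intro n; destruct n; simpl; try constructor; auto.
apply Forall_forall. intros z hz. rewrite Forall_forall in all. apply all.
rewrite <- (firstn_skipn n L). apply in_or_app. now left.
Qed.

Lemma nat_max_exists (P : nat -> Prop) (B : nat) :
  (exists n, P n) -> (forall n, P n -> (n <= B)%nat) -> exists N, P N /\ forall n, P n -> (n <= N)%nat.
Proof.
induction B as [|B IH]; intros ex H.
- destruct ex as [n hn]. exists n. split; [exact hn|]. intros m hm. specialize (H m hm). lia.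
- destruct (classic (P (S B))) as [h|h]; [now exists (S B)|].
  apply IH; [exact ex|]. intros n hn. specialize (H n hn).
  assert (n <> S B) by (intro; subst; auto). lia.
Qed.

Lemma nat_above (a : R) : 0 <= a -> exists K : nat, a < INR K <= a + 1.
Proof.
intro h. destruct (nfloor_ex a h) as [n [h1 h2]]. exists (S n). rewrite S_INR. lra.
Qed.

Definition order_of_magnitude (w l r : R) : R := Rmin (l * Rpower r (- (1 / 3))) (l * delta w (l * / r)).

Lemma cube_root_exists (r : R) : 1 <= r ->
  exists c, 1 <= c /\ c ^ 3 = r /\ Rpower r (- (1 / 3)) = / c.
Proof.
intro r1. exists (Rpower r (1 / 3)).
assert (c3 : Rpower r (1 / 3) ^ 3 = r).
{ rewrite <- (Rpower_pow 3) by apply exp_pos. rewrite Rpower_mult.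
  replace (1 / 3 * INR 3) with 1 by (simpl; field). apply Rpower_1. lra. }
split; [|split; [exact c3 | apply Rpower_Ropp]].
apply Rnot_lt_le. intro h. assert (0 < Rpower r (1 / 3)) by apply exp_pos.
set (c := Rpower r (1 / 3)) in *. assert (c ^ 3 < 1); [|lra].
assert (c * c < 1) by nra. nra.
Qed.

(** Each [K] is within one of its threshold, so [2 * K] is at most [4 * l / c + 2] in the first
    bound, where arcs of length [c / 2] give [2 * (c / 2) ^ 3 = r / 4 < r], and at most
    [6 * l * delta + 4] in the second; 6 covers both. *)
Lemma class_upper_bound (w l r : R) (G : curve) (L : list (Z * Z)) :
  1 <= l -> l <= r -> 0 <= w <= 1 -> in_class w l r G ->
  NoDup L -> (forall p, In p L -> lattice_points G p) ->
  INR (length L) <= 6 * (1 + order_of_magnitude w l r).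
Proof.
intros hl hlr hw HG nd hL.
destruct (smooth_plane_curve_exists G) as [X [Y [X1 [Y1 [X2 [Y2 HS]]]]]].
destruct (cube_root_exists r) as [c [c1 [c3 ec]]]; [lra|].
assert (x0 : 0 < l * / r) by (apply Rmult_lt_0_compat; [lra | apply Rinv_0_lt_compat; lra]).
assert (ic : 0 < / c) by (apply Rinv_0_lt_compat; lra).
pose proof (delta_gt0 w (l * / r) x0) as d0.
unfold order_of_magnitude. rewrite ec.
assert (B1 : INR (length L) <= 6 * (1 + l * / c)).
{ destruct (nat_above (l / (c / 2))) as [K [K1 K2]].
  { replace (l / (c / 2)) with (2 * (l * / c)) by (field; lra). nra. }
  assert (h : (length L <= 2 * K)%nat).
  { apply (lattice_points_le_curvature w l r G HG hl hlr hw X Y X1 Y1 X2 Y2 HS (c / 2)); auto; nra. }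
  apply le_INR in h. rewrite mult_INR in h. simpl (INR 2) in h.
  replace (l / (c / 2)) with (2 * (l * / c)) in K2 by (field; lra).
  assert (0 < l * / c) by nra. lra. }
assert (B2 : INR (length L) <= 6 * (1 + l * delta w (l * / r))).
{ destruct (delta_min w (l * / r) x0) as [[q [q1 E]] _]. rewrite E in *.
  destruct (nat_above (3 * (l * (INR q * (l * / r) + dist_int (INR q * w))) + 1)) as [K [K1 K2]]; [nra|].
  assert (h : (length L <= 2 * K)%nat).
  { now apply (lattice_points_le_slope w l r G HG hl hlr hw X Y X1 Y1 X2 Y2 HS q). }
  apply le_INR in h. rewrite mult_INR in h. simpl (INR 2) in h. lra. }
unfold Rmin. destruct Rle_dec; assumption.
Qed.

Lemma delta_scale (w x : R) : 0 < x -> delta w x <= 18 * delta w (x / 18).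
Proof.
intro x0. destruct (delta_witness w (x / 18)) as [q [p [q1 E]]]; [lra|].
rewrite E. pose proof (delta_le w x q p x0 q1). pose proof (Rabs_pos (IZR p - IZR q * w)). lra.
Qed.

Lemma class_lower_bound (w l r : R) :
  1 <= l -> l <= r -> 0 <= w <= 1 ->
  exists G pts, in_class w l r G /\ NoDup pts /\ (forall p, In p pts -> lattice_points G p) /\
    / 400000 * (1 + order_of_magnitude w l r) <= INR (length pts).
Proof.
intros hl hlr hw.
destruct (cube_root_exists r) as [c [c1 [c3 ec]]]; [lra|].
set (x := l * / r). assert (r0 : 0 < r) by lra. pose proof (Rinv_0_lt_compat r r0) as ir.
assert (x0 : 0 < x) by (apply Rmult_lt_0_compat; lra).
assert (x1 : x <= 1) by (replace 1 with (r * / r) by (field; lra); apply Rmult_le_compat_r; lra).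
assert (xr : x * r = l) by (unfold x; field; lra).
pose proof (delta_gt0 w x x0) as d0. pose proof (delta_scale w x x0) as d18.
set (T := Rmax c (/ delta w x)).
assert (T1 : c <= T) by apply Rmax_l. assert (T2 : / delta w x <= T) by apply Rmax_r.
assert (MT : order_of_magnitude w l r <= l / T).
{ unfold order_of_magnitude. rewrite ec. fold x. unfold T, Rmax. destruct Rle_dec.
  - unfold Rdiv. rewrite Rinv_inv. apply Rmin_r.
  - apply Rmin_l. }
(* [2160 = 18 * 120]: [many_fractions] asks for [120 <= A * delta w (x / 18)], and passing from [x]
   to [x / 18] costs at most a factor 18 in [delta]. *)
set (A := 2160 * T) in *. assert (A1 : 2160 <= A) by (unfold A; lra).
assert (lT : l / T = 2160 * (l / A)) by (unfold A; field; lra).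
assert (hA : 120 <= A * delta w (x / 18)).
{ assert (1 <= T * delta w x).
  { replace 1 with (/ delta w x * delta w x) by (field; lra). apply Rmult_le_compat_r; lra. }
  unfold A. nra. }
destruct (many_fractions w (x / 18) ltac:(lra) ltac:(lra) A hA) as [L [nd [len hL]]].
assert (len' : l / (36 * A) <= INR (length L)).
{ eapply Rle_trans; [|exact len]. apply Rmult_le_reg_r with (36 * A); [lra|].
  replace (l / (36 * A) * (36 * A)) with l by (field; lra).
  replace (x / 18 * A ^ 2 / 57600 * (36 * A)) with (x * A ^ 3 / 28800) by field.
  assert (T3 : r <= T ^ 3) by (rewrite <- c3; apply pow_incr; lra).
  replace (A ^ 3) with (2160 ^ 3 * T ^ 3) by (unfold A; ring).
  assert (x * r <= x * T ^ 3) by (apply Rmult_le_compat_l; lra). lra. }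
assert (lA : l / (36 * A) = l / A / 36) by (field; lra).
(* When the budget does not pay for one fraction, [order_of_magnitude] is at most [2160 * 36] and
   one lattice point suffices. Otherwise [n >= 1] points are obtained with [n + 1 > l / (36 * A)];
   the factor [/ 400000] leaves room for both cases. *)
destruct (Rlt_le_dec (l / (36 * A)) 1) as [small|big].
- destruct (curve_from_fractions w r l A (w + x / 18) [] hl hlr hw ltac:(lra) ltac:(lra)) as
    [G [pts [inG [ndp [lp latp]]]]].
  + repeat constructor.
  + intros z [<-|[]]. split; [unfold x; right; reflexivity | intro h; now elim h].
  + simpl. lra.
  + exists G, pts. split; [exact inG|]. split; [exact ndp|]. split; [exact latp|].
    rewrite lp. simpl. lra.
- destruct (nfloor_ex (l / (36 * A))) as [n [n1 n2]]; [lra|].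
  assert (nL : (n <= length L)%nat) by (apply INR_le; lra).
  destruct (sorted_permutation L nd) as [L' [P SS]].
  pose proof (StronglySorted_firstn n L' SS) as SSn.
  assert (lenn : length (firstn n L') = n).
  { rewrite length_firstn, <- (Permutation_length P). lia. }
  assert (inn : forall z, In z (firstn n L') -> In z L).
  { intros z hz. apply (Permutation_in z (Permutation_sym P)).
    rewrite <- (firstn_skipn n L'). apply in_or_app. now left. }
  assert (n0 : (1 <= n)%nat).
  { destruct n; [simpl in n2; lra | lia]. }
  assert (n0' : 1 <= INR n) by (apply (le_INR 1); exact n0).
  destruct (firstn n L') as [|sigma L0] eqn:EL; [simpl in lenn; lia|].
  destruct (curve_from_fractions w r l A sigma L0 hl hlr hw ltac:(lra)) as
    [G [pts [inG [ndp [lp latp]]]]].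
  + apply hL, inn. now left.
  + exact SSn.
  + intros z hz. destruct (hL z (inn z hz)) as [[_ hz2] hf]. split; [exact hz2 | intro; exact hf].
  + assert (INR (length L0) <= INR n) by (apply le_INR; simpl in lenn; lia).
    apply Rle_trans with (36 * A * (l / (36 * A))); [apply Rmult_le_compat_l; lra|].
    right. field. lra.
  + exists G, pts. split; [exact inG|]. split; [exact ndp|]. split; [exact latp|].
    rewrite lp. simpl in lenn. rewrite lenn. lra.
Qed.

Theorem mainTheorem1 :
  exists c1 c2 : R, 0 < c1 /\ 0 < c2 /\
  forall r l w : R, 1 <= l -> l <= r -> 0 <= w <= 1 ->
  exists N : nat, is_max_lattice_points w l r N /\
    c1 * (1 + Rmin (l * Rpower r (- (1 / 3))) (l * delta w (l * / r))) <= INR N /\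
    INR N <= c2 * (1 + Rmin (l * Rpower r (- (1 / 3))) (l * delta w (l * / r))).
Proof.
exists (/ 400000), 6. split; [lra|]. split; [lra|].
intros r l w hl hlr hw. fold (order_of_magnitude w l r).
destruct (class_lower_bound w l r hl hlr hw) as [G [pts [inG [ndp [latp lo]]]]].
set (M := order_of_magnitude w l r) in *.
destruct (nat_above (6 * (1 + M))) as [B [hB _]].
(* The empty list in the upper bound yields [0 <= 6 * (1 + M)]. *)
{ pose proof (class_upper_bound w l r G [] hl hlr hw inG (NoDup_nil _) ltac:(intros ? [])) as H.
  simpl in H. exact H. }
assert (bd : forall G L, in_class w l r G -> NoDup L -> (forall p, In p L -> lattice_points G p) ->
  INR (length L) <= 6 * (1 + M)) by (intros; eapply class_upper_bound; eauto).
assert (fin : forall G, in_class w l r G -> exists L : list (Z * Z), NoDup L /\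
   forall p, lattice_points G p <-> In p L).
{ intros G' inG'. apply (bounded_enumeration _ B). intros L nd hL.
  apply INR_le. specialize (bd G' L inG' nd hL). lra. }
(* The maximum exists because the counts are bounded by [B] over the whole class, which the lower
   bound has shown to be nonempty. *)
destruct (nat_max_exists (fun n => exists G L, in_class w l r G /\ NoDup L /\
   (forall p, lattice_points G p <-> In p L) /\ length L = n) B) as [N [[G1 [L1 [in1 [nd1 [h1 len1]]]]] mx]].
- destruct (fin G inG) as [L [nd h]]. exists (length L), G, L. auto.
- intros n [G' [L [inG' [nd [h <-]]]]]. apply INR_le.
  specialize (bd G' L inG' nd (fun p => proj2 (h p))). lra.
- exists N. split; [split|split].
  + exists G1. split; [exact in1|]. rewrite <- len1. now apply NoDup_cardinal.
  + intros G' inG'. destruct (fin G' inG') as [L [nd h]]. exists (length L).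
    split; [now apply NoDup_cardinal|]. apply mx. exists G', L. auto.
  + eapply Rle_trans; [exact lo|]. apply le_INR.
    destruct (fin G inG) as [L [nd h]]. apply Nat.le_trans with (length L).
    * apply NoDup_incl_length; [exact ndp|]. intros p hp. now apply h, latp.
    * apply mx. exists G, L. auto.
  + rewrite <- len1. apply (bd G1 L1 in1 nd1). intro p. apply h1.
Qed.
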